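(* Let $H$ be a compact subgroup of a locally compact group $G$ and let $\lambda$ be a strongly quasi-invariant measure on $G/H$ arising from a rho-function $\rho$ for the pair $(G,H)$. Then the Banach algebra $L^1(G/H,\lambda)$, identified with the subspace $\Lambda=\{\lambda_\varphi:\varphi\in L^1(G/H,\lambda)\}$ of $M(G/H)$, is a two-sided ideal of the Banach algebra $(M(G/H),\ast)$.
   Context: $G/H$ is the space of left cosets. For $\varphi\in L^1(G/H,\lambda)$, $\lambda_\varphi\in M(G/H)$ is the measure $d\lambda_\varphi(xH)=\varphi(xH)\,d\lambda(xH)$; the identification of $L^1(G/H,\lambda)$ with $\Lambda$ is $\varphi\mapsto\lambda_\varphi$. A rho-function for $(G,H)$ is a continuous $\rho:G\to(0,+\infty)$ with $\rho(xh)=\Delta_H(h)\Delta_G(h)^{-1}\rho(x)$ for $x\in G$, $h\in H$, where $\Delta_G,\Delta_H$ are the modular functions. A Radon measure $\lambda$ on $G/H$ is strongly quasi-invariant if, with $\lambda_x(E)=\lambda(xE)$ for Borel $E$, there is a continuous function $\theta:G\times G/H\to(0,+\infty)$ with $d\lambda_x(yH)=\theta(x,yH)\,d\lambda(yH)$ for every $x\in G$; it arises from $\rho$ if $\int_G f(x)\,dx=\int_{G/H}\int_H\frac{f(xh)}{\rho(xh)}\,dh\,d\lambda(xH)$ for all $f\in C_c(G)$ ($dx$ left Haar measure on $G$). $M(G)$ and $M(G/H)$ denote the spaces of all complex bounded Radon measures on $G$ and $G/H$, normed by total variation; a measure is identified with the bounded linear functional it defines on $C_c(G)$, respectively $C_c(G/H)$.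 The convolution on $M(G)$ is $\mu_1\ast\mu_2(f)=\int_G\int_G f(xy)\,d\mu_1(x)\,d\mu_2(y)$ for $f\in C_c(G)$. Let $\pi_H:G\to G/H$ be the canonical map and $\varphi_{\pi_H}=\varphi\circ\pi_H$. Let $P_H:C_c(G)\to C_c(G/H)$, $P_Hf(xH)=\int_H f(xh)\,dh$, where $dh$ is the normalized Haar measure of $H$. For $\sigma\in M(G/H)$ put $\sigma_{P_H}:=\sigma\circ P_H\in M(G)$. Define $R_H:M(G)\to M(G/H)$ by $R_H\mu(\varphi)=\mu(\varphi_{\pi_H})$ for $\varphi\in C_c(G/H)$. The convolution on $M(G/H)$ is $\sigma_1\ast\sigma_2:=R_H(\sigma_{1_{P_H}}\ast\sigma_{2_{P_H}})$. *)

(* Defs.v *)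
From HB Require Import structures.
From mathcomp Require Import all_boot all_order all_algebra.
From mathcomp Require Import all_classical all_reals all_analysis.
From mathcomp Require Import complex.

Set Implicit Arguments.
Unset Strict Implicit.
Unset Printing Implicit Defensive.

Import Order.TTheory GRing.Theory Num.Theory.
Import numFieldNormedType.Exports.

Local Open Scope classical_set_scope.
Local Open Scope ring_scope.
Local Open Scope complex_scope.
Local Open Scope quotient_scope.

(** Topological groups. Carriers are pointed because the library's measurable
    types are; the chosen point plays no role. *)

HB.mixin Record isTopologicalGroup G of PointedTopological G & Group G := {
  mulg_continuous : continuous (fun x : G * G => (x.1 * x.2)%g) ;
  invg_continuous : continuous (fun x : G => (x^-1)%g)
}.

#[short(type="topologicalGroupType")]
HB.structure Definition TopologicalGroup :=
  {G of PointedTopological G & Group G & isTopologicalGroup G}.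

Definition lc_group (G : topologicalGroupType) : Prop :=
  hausdorff_space G /\ locally_compact [set: G].

Record subgroup (G : topologicalGroupType) := Subgroup {
  subgroup_set :> set G ;
  subgroup1 : subgroup_set 1%g ;
  subgroupM : forall x y, subgroup_set x -> subgroup_set y ->
    subgroup_set (x * y)%g ;
  subgroupV : forall x, subgroup_set x -> subgroup_set (x^-1)%g
}.

(* H as a topological group in its own right (relative topology) *)
Definition subgroup_type (G : topologicalGroupType) (H : subgroup G) : Type :=
  set_type H.

Section subgroup_type.
Context {G : topologicalGroupType} (H : subgroup G).
Local Notation HT := (subgroup_type H).

Let mkH (x : G) (Hx : (H : set G) x) : HT := exist _ x (mem_set Hx).

Let memH (x : HT) : (H : set G) (\val x). Proof. exact: set_mem (valP x). Qed.

Let one : HT := mkH (subgroup1 H).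
Let mul (x y : HT) : HT := mkH (subgroupM (memH x) (memH y)).
Let inv (x : HT) : HT := mkH (subgroupV (memH x)).

HB.instance Definition _ := Topological.copy HT (set_type H).
HB.instance Definition _ := isPointed.Build HT one.

Let mulA : associative mul.
Proof. by move=> x y z; apply/val_inj; rewrite /= mulgA. Qed.
Let mul1 : left_id one mul.
Proof. by move=> x; apply/val_inj; rewrite /= mul1g. Qed.
Let mulr1 : right_id one mul.
Proof. by move=> x; apply/val_inj; rewrite /= mulg1. Qed.
Let mulV : left_inverse one inv mul.
Proof. by move=> x; apply/val_inj; rewrite /= mulVg. Qed.
Let mulrV : right_inverse one inv mul.
Proof. by move=> x; apply/val_inj; rewrite /= mulgV. Qed.

HB.instance Definition _ := isGroup.Build HT mulA mul1 mulr1 mulV mulrV.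

Let val_cont : continuous (\val : HT -> G).
Proof. exact: (@initial_continuous HT G set_val). Qed.

Let to_sub_cont (T : topologicalType) (f : T -> HT) :
  continuous (\val \o f : T -> G) -> continuous f.
Proof.
move=> cf; apply/continuousP => A [B oB <-].
by move/continuousP : cf => /(_ _ oB).
Qed.

Let mul_cont : continuous (fun x : HT * HT => (x.1 * x.2)%g).
Proof.
apply: to_sub_cont => z /=.
apply: (@continuous_comp _ _ _ (fun z : HT * HT => (\val z.1, \val z.2) : G * G)
  (fun x : G * G => (x.1 * x.2)%g)); last exact: mulg_continuous.
apply: cvg_pair => /=.
- by apply: cvg_comp; [exact: cvg_fst|exact: val_cont].
- by apply: cvg_comp; [exact: cvg_snd|exact: val_cont].
Qed.

Let inv_cont : continuous (fun x : HT => (x^-1)%g).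
Proof.
apply: to_sub_cont => z /=.
exact: (cvg_comp _ _ (@val_cont z) (@invg_continuous G (\val z))).
Qed.

HB.instance Definition _ := isTopologicalGroup.Build HT mul_cont inv_cont.

End subgroup_type.

(** The space G/H of left cosets, with the quotient topology *)

Section coset_space.
Context {G : topologicalGroupType} (H : subgroup G).

Definition coset_rel (x y : G) : bool := `[< (H : set G) (x^-1 * y)%g >].

Let coset_rel_equiv : equiv_class_of coset_rel.
Proof.
split=> [x|x y|y x z].
- by apply/asboolP; rewrite mulVg; exact: subgroup1.
- by apply/asboolP/asboolP => /subgroupV; rewrite invgM invgK.
- move=> /asboolP xy /asboolP yz; apply/asboolP.
  by have := subgroupM xy yz; rewrite mulgA mulgK.
Qed.

Canonical coset_equiv := EquivRelPack coset_rel_equiv.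

Definition coset_space : ptopologicalType :=
  quotient_topology {eq_quot coset_equiv}.

Definition coset_proj : G -> coset_space :=
  \pi_(quotient_topology {eq_quot coset_equiv}).

Definition coset_repr : coset_space -> G :=
  @repr _ (quotient_topology {eq_quot coset_equiv}).

Definition coset_act (x : G) (q : coset_space) : coset_space :=
  coset_proj (x * coset_repr q)%g.

End coset_space.

(** Borel measures, Radon measures and integration *)

Definition borel (X : ptopologicalType) := g_sigma_algebraType (@open X).

Section radon.
Context {R : realType} {X : ptopologicalType}.

Definition radon (m : {measure set (borel X) -> \bar R}) : Prop :=
  [/\ forall K : set X, compact K -> (m K < +oo)%E,
      forall E : set (borel X), measurable E ->
        m E = ereal_inf [set m U | U in [set U : set X | open U /\ E `<=` U]]
    & forall U : set X, open U ->
        m U = ereal_sup [set m K | K in [set K : set X | compact K /\ K `<=` U]]].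

Definition integrableC (m : {measure set (borel X) -> \bar R})
    (f : X -> R[i]) : Prop :=
  m.-integrable [set: borel X] (fun x => (complex.Re (f x))%:E) /\
  m.-integrable [set: borel X] (fun x => (complex.Im (f x))%:E).

Definition integralC (m : {measure set (borel X) -> \bar R})
    (f : X -> R[i]) : R[i] :=
  (\int[m]_x complex.Re (f x)) +i* (\int[m]_x complex.Im (f x)).

(* continuity is for the norm topology of the field R[i] *)
Definition Cc (f : X -> R[i]) : Prop :=
  continuous (f : X -> R[i]^o) /\ compact (closure [set x | f x != 0]).

End radon.

(** Complex measures, given by their real and imaginary parts. Charges are set
    functions defined on all sets but only meaningful on measurable ones. *)

Section cmeasure.
Context {R : realType} {X : ptopologicalType}.

Record cmeasure := CMeasure {
  cmre : {charge set (borel X) -> \bar R} ;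
  cmim : {charge set (borel X) -> \bar R}
}.

Definition cmeq (mu nu : cmeasure) : Prop :=
  forall E : set (borel X), measurable E ->
    cmre mu E = cmre nu E /\ cmim mu E = cmim nu E.

Definition cm0 : cmeasure := CMeasure czero czero.

Definition cmadd (mu nu : cmeasure) : cmeasure :=
  CMeasure (cadd (cmre mu) (cmre nu)) (cadd (cmim mu) (cmim nu)).

Definition cmscale (z : R[i]) (mu : cmeasure) : cmeasure :=
  CMeasure
    (cadd (cscale (complex.Re z) (cmre mu)) (cscale (- complex.Im z) (cmim mu)))
    (cadd (cscale (complex.Im z) (cmre mu)) (cscale (complex.Re z) (cmim mu))).

(* the Jordan decomposition; by essential uniqueness of the Hahn decomposition
   the choice made here is immaterial *)
Lemma hahn_ex (nu : {charge set (borel X) -> \bar R}) : {PN : set (borel X) * set (borel X) |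
  hahn_decomposition nu PN.1 PN.2}.
Proof.
apply: cid; have [P [N h]] := Hahn_decomposition nu.
by exists (P, N).
Qed.

Definition pos_part (nu : {charge set (borel X) -> \bar R}) :
  {measure set (borel X) -> \bar R} := jordan_pos (svalP (hahn_ex nu)).

Definition neg_part (nu : {charge set (borel X) -> \bar R}) :
  {measure set (borel X) -> \bar R} := jordan_neg (svalP (hahn_ex nu)).

Definition radon_charge (nu : {charge set (borel X) -> \bar R}) : Prop :=
  radon (pos_part nu) /\ radon (neg_part nu).

(* the set M(X) of complex Radon measures; boundedness is automatic because
   charges are finite *)
Definition M : set cmeasure :=
  [set mu | radon_charge (cmre mu) /\ radon_charge (cmim mu)].

Definition integral_charge (nu : {charge set (borel X) -> \bar R})
    (f : X -> R[i]) : R[i] :=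
  integralC (pos_part nu) f - integralC (neg_part nu) f.

Definition cmint (mu : cmeasure) (f : X -> R[i]) : R[i] :=
  integral_charge (cmre mu) f + 'i * integral_charge (cmim mu) f.

(* mu is the element of M(X) identified with the functional I on C_c(X) *)
Definition represents (mu : cmeasure) (I : (X -> R[i]) -> R[i]) : Prop :=
  M mu /\ forall f, Cc f -> cmint mu f = I f.

Record L1 (lam : {measure set (borel X) -> \bar R}) := MkL1 {
  L1_fun :> X -> R[i] ;
  L1_integrable : integrableC lam L1_fun
}.

Definition density (lam : {measure set (borel X) -> \bar R}) (phi : L1 lam) :
    cmeasure :=
  CMeasure (induced_charge (L1_integrable phi).1)
           (induced_charge (L1_integrable phi).2).

Definition Lambda (lam : {measure set (borel X) -> \bar R}) : set cmeasure :=
  [set nu | exists phi : L1 lam, cmeq nu (density phi)].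

End cmeasure.
Arguments cmeasure : clear implicits.
Arguments M : clear implicits.

(** Haar measures and modular functions *)

Section haar.
Context {R : realType} {G : topologicalGroupType}.
Implicit Type m : {measure set (borel G) -> \bar R}.

Definition left_haar m : Prop :=
  [/\ radon m, m [set: G] != 0%E &
      forall (x : G) (E : set (borel G)), measurable E ->
        m [set (x * y)%g | y in E] = m E].

(* the modular function of the group with left Haar measure m *)
Definition modular m (Delta : G -> R) : Prop :=
  (forall x, 0 < Delta x) /\
  forall (x : G) (E : set (borel G)), measurable E ->
    m [set (y * x)%g | y in E] = ((Delta x)%:E * m E)%E.

Definition conv_group (mu1 mu2 mu : cmeasure R G) : Prop :=
  represents mu (fun f => cmint mu2 (fun y => cmint mu1 (fun x => f (x * y)%g))).

End haar.

(** Homogeneous spaces *)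

Section homogeneous.
Context {R : realType} {G : topologicalGroupType} {H : subgroup G}.

Definition rho_function (DeltaG : G -> R) (DeltaH : subgroup_type H -> R)
    (rho : G -> R) : Prop :=
  [/\ continuous rho, forall x, 0 < rho x &
      forall (x : G) (h : subgroup_type H),
        rho (x * \val h)%g = DeltaH h / DeltaG (\val h) * rho x].

Definition strongly_quasi_invariant
    (lam : {measure set (borel (coset_space H)) -> \bar R}) : Prop :=
  radon lam /\
  exists theta : G * coset_space H -> R,
    [/\ continuous theta, forall p, 0 < theta p &
        forall (x : G) (E : set (borel (coset_space H))), measurable E ->
          lam [set coset_act x q | q in E] =
          (\int[lam]_(q in E) (theta (x, q))%:E)%E].

(* the integral does not depend on the representative of the coset when mH is
   left invariant *)
Definition P_H (mH : {measure set (borel (subgroup_type H)) -> \bar R})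
    (f : G -> R[i]) (q : coset_space H) : R[i] :=
  integralC mH (fun h => f (coset_repr q * \val h)%g).

Definition arises_from (mG : {measure set (borel G) -> \bar R})
    (mH : {measure set (borel (subgroup_type H)) -> \bar R}) (rho : G -> R)
    (lam : {measure set (borel (coset_space H)) -> \bar R}) : Prop :=
  forall f : G -> R[i], Cc f ->
    integralC mG f = integralC lam (P_H mH (fun x => f x / (rho x)%:C)).

(* tau is the measure sigma o P_H *)
Definition lift_PH (mH : {measure set (borel (subgroup_type H)) -> \bar R})
    (sigma : cmeasure R (coset_space H)) (tau : cmeasure R G) : Prop :=
  represents tau (fun f => cmint sigma (P_H mH f)).

(* sigma is the measure R_H mu *)
Definition push_RH (mu : cmeasure R G) (sigma : cmeasure R (coset_space H)) :
    Prop :=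
  represents sigma (fun phi => cmint mu (phi \o @coset_proj G H)).

(* sigma is the convolution of sigma1 and sigma2; as a bounded Radon measure is
   determined by the functional it defines on C_c, the intermediate measures
   and sigma are unique up to cmeq *)
Definition conv (mH : {measure set (borel (subgroup_type H)) -> \bar R})
    (sigma1 sigma2 sigma : cmeasure R (coset_space H)) : Prop :=
  exists tau1 tau2 mu, [/\ lift_PH mH sigma1 tau1, lift_PH mH sigma2 tau2,
    conv_group tau1 tau2 mu & push_RH mu sigma].

(* The products with elements of I are required to exist. *)
Definition two_sided_ideal
    (mH : {measure set (borel (subgroup_type H)) -> \bar R})
    (I : set (cmeasure R (coset_space H))) : Prop :=
  [/\ I `<=` M R (coset_space H),
      I cm0,
      forall mu nu, I mu -> I nu -> I (cmadd mu nu),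
      forall (z : R[i]) mu, I mu -> I (cmscale z mu) &
      forall sigma nu, M R (coset_space H) sigma -> I nu ->
        (exists2 kappa, conv mH sigma nu kappa & I kappa) /\
        (exists2 kappa, conv mH nu sigma kappa & I kappa)].

End homogeneous.

(* Main.v *)
Require Import Defs.
From HB Require Import structures.
From mathcomp Require Import all_boot all_order all_algebra.
From mathcomp Require Import all_classical all_reals all_analysis.
From mathcomp Require Import measurable_realfun complex finmap ring lra.

Set Implicit Arguments.
Unset Strict Implicit.
Unset Printing Implicit Defensive.

Import Order.TTheory GRing.Theory Num.Theory.
Import numFieldNormedType.Exports.

Local Open Scope classical_set_scope.
Local Open Scope ring_scope.

(** All the measures involved split into four finite positive Radon measures,
    with coefficients 1, i, -1 and -i. On positive measures the lift by [P_H]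
    and the convolution are mixtures [\int k q E d sigma(q)] of finite Radon
    measures [k q] that depend on [q] lower semicontinuously on open sets; such
    a mixture is again Radon.

    By Radon-Nikodym, [Lambda lam] consists of the complex Radon measures
    vanishing on the compact [lam]-null sets. Let [C] be such a set and
    [L = pi^-1(C)]. Testing Weil's formula against Urysohn functions shows that
    [mG L = 0], and that the lift of a [lam]-absolutely continuous measure
    vanishes on the compact [mG]-null sets; left and right translates of [L]
    are among these, because the modular function rescales [mG]. Hence, if one
    factor of a convolution is in [Lambda lam], all its translates vanish on
    [L], and so does the convolution. *)

(** * Compact sets *)

(** No second countability or sigma-finiteness is assumed: the Borel sets of [G * G] can exceed the
    product sigma-algebra, and [lam] and [mG] are known to be inner regular only on open sets and on
    sets of finite measure. This is why absolute continuity is tested on compact sets: by inner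
    regularity, a finite Radon measure that vanishes on the compact subsets of a Borel set vanishes
    on it. Lower semicontinuity of the kernels comes from the tube lemma; it gives measurability in
    the parameter for all Borel sets and, beyond that, lets one compact set serve for all parameters
    in a compact set.

    The four positive measures from which a complex measure is assembled need not be its Jordan
    parts, but they dominate them, which is enough to pass on Radonness and null sets.

    The two sides of the ideal property are not symmetric. As [conv_group] integrates the left
    factor inside, an absolutely continuous left factor kills the inner integral at once, whereas
    for the right factor the order of integration has to be exchanged. *)

Section topology.

(** The finite subcover argument, made once. In its uses [P] asks for a further witness or an
    estimate, and the union step merges two of them. *)
Lemma compact_induction (T : ptopologicalType) (K : set T) (P : set T -> Prop) :
  compact K -> P set0 ->
  (forall A B, open A -> open B -> P A -> P B -> P (A `|` B)) ->
  (forall x, K x -> exists U, [/\ open U, U x & P U]) ->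
  exists W, [/\ open W, K `<=` W & P W].
Proof.
move=> cK P0 PU loc.
have /choice[U HU] x : exists U, K x -> [/\ open U, U x & P U].
  have [Kx|nKx] := pselect (K x); last by exists set0.
  by have [U ?] := loc x Kx; exists U.
move: cK; rewrite compact_cover => /(_ T K U).
case=> [x /HU[]//|x Kx|D' D'K KD'].
  by exists x => //; have [] := HU x Kx.
exists (\big[setU/set0]_(x <- D') U x).
suff [oW PW] : open (\big[setU/set0]_(x <- D') U x) /\
    P (\big[setU/set0]_(x <- D') U x).
  by split => //; rewrite -bigcup_fset.
rewrite big_seq; elim/big_ind : _ => [|A B [oA PA] [oB PB]|x xD'].
- by split => //; exact: open0.
- by split; [exact: openU|exact: PU].
- by have /HU[] : K x by apply/set_mem/D'K.
Qed.

(** The tube lemma, for a continuous function of two variables. *)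
Lemma near_compact_image (A B C : topologicalType) (f : A * B -> C)
    (K : set B) (U : set C) (a : A) :
  continuous f -> compact K -> open U -> (forall b, K b -> U (f (a, b))) ->
  \forall a' \near a, forall b, K b -> U (f (a', b)).
Proof.
move=> cf /compact_near_coveringP cK oU KU.
apply: (cK _ (nbhs a) (fun a' b => U (f (a', b)))) => b Kb.
have /cf [] : nbhs (f (a, b)) U by apply: open_nbhs_nbhs; split => //; exact: KU.
move=> [P Q] [/= Pa Qb] PQ.
by exists (Q, P) => //= -[y x] [/= Qy Px]; exact: (PQ (x, y)).
Qed.

Context {X : ptopologicalType}.
Hypotheses (hX : hausdorff_space X) (lX : locally_compact [set: X]).

Lemma compact_nbhs_ex (x : X) : exists V, [/\ compact V, closed V & nbhs x V].
Proof.
have [V Vx [cV clV]] := lX (I : [set: X] x).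
by exists V; split => //; move: Vx; rewrite /within /=; apply: filterS => y; exact.
Qed.

Lemma compact_open_between (K U : set X) : compact K -> open U -> K `<=` U ->
  exists V, [/\ open V, K `<=` V, compact (closure V) & closure V `<=` U].
Proof.
move=> cK oU KU.
have [||x Kx|W [oW KW [cW WU]]] := @compact_induction X K
    (fun V => compact (closure V) /\ closure V `<=` U) cK.
- by rewrite closure0; split => //; exact: compact0.
- move=> A B _ _ [cA AU] [cB BU]; rewrite closureU; split.
    exact: compactU.
  by rewrite subUset.
- have [V [cV clV Vx]] := compact_nbhs_ex x.
  have Ux : nbhs x (U `&` V).
    by apply: filterI => //; apply: open_nbhs_nbhs; split => //; exact: KU.
  have [B Bx BUV] := compact_regular hX cV Vx Ux.
  exists B°; split; first exact: open_interior.
    exact: nbhs_singleton (nbhs_interior Bx).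
  have BB : closure B° `<=` U `&` V.
    by apply: subset_trans BUV; apply: closureS; exact: interior_subset.
  split; last by move=> y /BB[].
  apply: subclosed_compact cV _; first exact: closed_closure.
  by move=> y /BB[].
- by exists W.
Qed.

(** The one-point compactification is compact Hausdorff, hence normal, so it separates [K] from the
    complement of a relatively compact open [V]. That complement contains the point at infinity, so
    the support stays in the closure of [V]. *)
Lemma urysohn_compact (R : realType) (K U : set X) :
  compact K -> open U -> K `<=` U ->
  exists f : X -> R, [/\ continuous f, forall x, 0 <= f x <= 1,
    forall x, K x -> f x = 1, forall x, ~ U x -> f x = 0 &
    compact (closure [set x | f x != 0])].
Proof.
move=> cK oU KU; have [V [oV KV cV VU]] := compact_open_between cK oU KU.
set opc := one_point_compactification X.
have hopc : hausdorff_space opc by exact: one_point_compactification_hausdorff.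
have nopc : normal_space opc.
  exact: compact_normal hopc one_point_compactification_compact.
have clA : closed (~` (Some @` V : set opc)).
  by apply: open_closedC; exact: one_point_compactification_open_some.
have clB : closed (Some @` K : set opc).
  apply: compact_closed => //; apply: continuous_compact => //.
  exact/continuous_subspaceT/one_point_compactification_some_continuous.
have AB : ~` (Some @` V : set opc) `&` (Some @` K : set opc) = set0.
  rewrite setIC -subset0 => _ [[x Kx <-]]; apply.
  by exists x => //; exact: KV.
have /(@uniform_separatorP _ R)[f [cf f01 fA fB]] :=
  (@normal_separatorP R opc).1 nopc _ _ clA clB AB.
have f0 x : ~ V x -> f (Some x) = 0.
  move=> Vx; have /fA// : (f @` (~` (Some @` V : set opc))) (f (Some x)).
  by exists (Some x) => // -[y Vy [yx]]; apply: Vx; rewrite -yx.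
exists (fun x => f (Some x)); split.
- move=> x; apply: (@continuous_comp _ _ _ (Some : X -> opc) f); last exact: cf.
  exact: one_point_compactification_some_continuous.
- by move=> x; have /= := f01 (f (Some x)); rewrite in_itv/=; apply; exists (Some x).
- move=> x Kx; have /fB// : (f @` (Some @` K : set opc)) (f (Some x)).
  by exists (Some x) => //; exists x.
- by move=> x Ux; apply: f0 => /subset_closure/VU.
- apply: subclosed_compact cV _; first exact: closed_closure.
  apply: closureS => x /= /eqP fx.
  by apply: contrapT => /f0.
Qed.

End topology.

(** * Finite Radon measures *)

(** [pushforward] bundled as a measure; it is left transparent so that its value at a set unfolds to
    the measure of the preimage. *)
Definition image_measure d d' (T1 : measurableType d) (T2 : measurableType d')
    (R : realType) (m : {measure set T1 -> \bar R}) (f : T1 -> T2)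
    (mf : measurable_fun [set: T1] f) : {measure set T2 -> \bar R}.
Proof. by refine (pushforward m f : {measure set T2 -> \bar R}). Defined.

Section borel.
Context {X : ptopologicalType}.
Local Notation BX := (borel X).

Lemma open_borel (U : set X) : open U -> measurable (U : set BX).
Proof. exact: sub_sigma_algebra. Qed.

Lemma closed_borel (F : set X) : closed F -> measurable (F : set BX).
Proof.
by move=> /closed_openC/open_borel/measurableC; rewrite setCK.
Qed.

Lemma compact_borel (K : set X) :
  hausdorff_space X -> compact K -> measurable (K : set BX).
Proof. by move=> hX cK; apply: closed_borel; exact: compact_closed. Qed.

Lemma continuous_borel (Y : ptopologicalType) (f : X -> Y) :
  continuous f -> measurable_fun [set: BX] (f : BX -> borel Y).
Proof.
move=> /continuousP cf; apply: (@measurability _ _ BX (borel Y) setT f (@open Y)) => //.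
by move=> _ [B oB <-]; rewrite setTI; apply: open_borel; exact: cf.
Qed.

Lemma continuous_borel_real (R : realType) (f : X -> R) :
  continuous f -> measurable_fun [set: BX] (f : BX -> R).
Proof.
move=> /continuousP cf; apply: (measurability _ (RGenOpens.measurableE R)).
move=> _ [_ [a [b ->] <-]]; rewrite setTI; apply: open_borel; apply: cf.
exact: interval_open.
Qed.

Lemma lsc_borel (R : realType) (F : X -> \bar R) :
  (forall t : R, open [set x | (t%:E < F x)%E]) ->
  measurable_fun [set: BX] F.
Proof.
move=> oF; apply: (measurability _ (measurable_realfun.ErealGenOInfty.measurableE R)).
move=> /= _ [_ [a ->]] <-; rewrite setTI preimage_itvoy.
exact: open_borel.
Qed.

End borel.

Section regularity.
Local Open Scope ereal_scope.
Context {R : realType} {X : ptopologicalType}.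
Local Notation BX := (borel X).
Implicit Type m : {measure set BX -> \bar R}.

Definition inner_regular m (A : set BX) : Prop :=
  forall e : R, (0 < e)%R ->
  exists K : set X, [/\ compact K, K `<=` A & m (A `\` K) <= e%:E].

Definition finite_radon m := m setT < +oo /\ radon m.

Hypothesis hX : hausdorff_space X.

Lemma le_meas m (A B : set BX) : measurable A -> measurable B ->
  A `<=` B -> m A <= m B.
Proof. by move=> mA mB AB; exact: le_measure (mem_set mA) (mem_set mB) AB. Qed.

Lemma measDsub m (A B : set BX) : measurable A -> measurable B ->
  B `<=` A -> m A < +oo -> m (A `\` B) = m A - m B.
Proof. by move=> mA mB BA Afin; rewrite measureD// setIidr. Qed.

(** [radon] gives inner regularity on open sets only. Take [U] open around [E], [F] compact in [U],
    and [V] open around the excess of [U] over [E]. The compact set [F] minus [V] lies in [E] and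
    loses at most [e / 3] to [F] and [2 * e / 3] to [V]. *)
Lemma radon_inner_regular m (E : set BX) : radon m -> measurable E ->
  m E < +oo -> inner_regular m E.
Proof.
move=> [mfin mout minn] mE Efin e e0.
have e30 : (0 < e / 3)%R by rewrite divr_gt0.
have outer (A : set BX) : measurable A -> m A < +oo ->
    exists U : set X, [/\ open U, A `<=` U & m U < m A + (e / 3)%:E].
  move=> mA Afin.
  have Af : ereal_inf [set m U | U in [set U : set X | open U /\ A `<=` U]] \is a fin_num.
    by rewrite -mout// ge0_fin_numE.
  have [_ [U [oU AU] <-]] := lb_ereal_inf_adherent e30 Af.
  by rewrite -mout// => mU; exists U.
have [U [oU EU mU]] := outer _ mE Efin.
have mUb : measurable (U : set BX) by exact: open_borel.
have Ufin : m U < +oo.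
  by apply: (lt_trans mU); rewrite lte_add_pinfty ?ltry.
have UE : m (U `\` E) <= (e / 3)%:E.
  rewrite measureD// leeBlDl; last by rewrite setIidr// ge0_fin_numE.
  by rewrite setIidr//; exact: ltW.
have [F [cF FU mF]] : exists F : set X,
    [/\ compact F, F `<=` U & m (U `\` F) <= (e / 3)%:E].
  have Uf : ereal_sup [set m K | K in [set K : set X | compact K /\ K `<=` U]] \is a fin_num.
    by rewrite -minn// ge0_fin_numE.
  have [_ [K [cK KU] <-]] := ub_ereal_sup_adherent e30 Uf.
  rewrite -minn// => mK; exists K; split => //.
  have mKb : measurable (K : set BX) by exact: compact_borel.
  have Kf : m K \is a fin_num.
    by rewrite ge0_fin_numE// (le_lt_trans _ Ufin)//; exact: le_meas.
  rewrite measureD// setIidr// leeBlDr// -leeBlDl//.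
  exact: ltW.
have mUE : measurable (U `\` E : set BX) by exact: measurableD.
have [|V [oV UV mV]] := outer _ mUE.
  by apply: (le_lt_trans UE); rewrite ltry.
have mVb : measurable (V : set BX) by exact: open_borel.
have mFb : measurable (F : set BX) by exact: compact_borel.
exists (F `&` ~` V); split.
- by apply: compact_closedI => //; exact: open_closedC.
- by move=> x [Fx Vx]; apply: contrapT => Ex; apply: Vx; apply: UV; split => //; exact: FU.
apply: (@le_trans _ _ (m ((U `\` F) `|` V))).
  apply: le_meas.
  - by apply: measurableD => //; apply: measurableI => //; exact: measurableC.
  - by apply: measurableU => //; exact: measurableD.
  - move=> x [Ex]; rewrite not_andE notK => -[nF|Vx]; [left|right] => //.
    by split => //; exact: EU.
apply: (le_trans (measureU2 _ _ _)) => //; first exact: measurableD.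
have -> : e%:E = (e / 3)%:E + ((e / 3)%:E + (e / 3)%:E).
  by rewrite -!EFinD; congr EFin; lra.
apply: leeD => //; apply: (le_trans (ltW mV)).
by rewrite leeD2r.
Qed.

Lemma finite_radon_inner m (E : set BX) : finite_radon m -> measurable E ->
  inner_regular m E.
Proof.
move=> [mT rm] mE; apply: radon_inner_regular => //.
by rewrite (le_lt_trans _ mT)//; exact: le_meas.
Qed.

Lemma finite_radon_lt m (E : set BX) (t : R) : finite_radon m ->
  measurable E -> t%:E < m E ->
  exists K : set X, [/\ compact K, K `<=` E & t%:E < m K].
Proof.
move=> mR mE tE.
have fin (A : set BX) : measurable A -> m A \is a fin_num.
  by move=> mA; rewrite ge0_fin_numE// (le_lt_trans _ mR.1)//; exact: le_meas.
pose r := ((fine (m E) - t) / 2)%R.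
have r0 : (0 < r)%R by rewrite divr_gt0// subr_gt0 -lte_fin fineK// fin.
have [K [cK KE mK]] := finite_radon_inner mR mE r0.
exists K; split => //.
have mKb := compact_borel hX cK.
move: mK; rewrite measDsub//; last by rewrite ltey_eq fin.
move: tE; rewrite -(fineK (fin _ mE)) -(fineK (fin _ mKb)) -EFinB lee_fin !lte_fin.
by rewrite /r /=; lra.
Qed.

(* The Borel sets squeezed between a closed and an open set up to small
   measure form a sigma-algebra. *)
Lemma finite_closed_open_approx m (E : set BX) : m setT < +oo ->
  (forall U : set X, open U -> inner_regular m U) -> measurable E ->
  forall e : R, (0 < e)%R -> exists F U : set X,
    [/\ closed F, open U, F `<=` E, E `<=` U & m (U `\` F) <= e%:E].
Proof.
move=> mT inn.
have fin (A : set BX) : measurable A -> m A < +oo.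
  by move=> mA; rewrite (le_lt_trans _ mT)//; exact: le_meas.
pose P (E : set X) := forall e : R, (0 < e)%R -> exists F U : set X,
    [/\ closed F, open U, F `<=` E, E `<=` U & m (U `\` F) <= e%:E].
suff : <<s @open X >> `<=` P by exact.
apply: smallest_sub; last first.
  move=> U oU e e0; have [K [cK KU mK]] := inn _ oU _ e0.
  by exists K, U; split => //; exact: compact_closed.
split.
- move=> e e0; exists set0, set0; split => //; [exact: closed0|exact: open0|].
  by rewrite setD0 measure0 lee_fin ltW.
- move=> A PA e e0; have [F [U [cF oU FA AU mFU]]] := PA e e0.
  exists (~` U), (~` F); rewrite setTD; split.
  + exact: open_closedC.
  + exact: closed_openC.
  + exact: subsetC.
  + exact: subsetC.
  + by rewrite setDE setCK setIC -setDE.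
- move=> A PA e e0.
  have e20 : (0 < e / 2)%R by rewrite divr_gt0.
  have /choice[f /choice[g fg]] n : exists F U : set X,
      [/\ closed F, open U, F `<=` A n, A n `<=` U &
         m (U `\` F) <= (e / 2 / (2 ^ n.+1)%:R)%:E].
    by apply: PA; rewrite divr_gt0// ltr0n expn_gt0.
  have ob n : measurable (g n : set BX) by apply: open_borel; have [] := fg n.
  have cb n : measurable (f n : set BX) by apply: closed_borel; have [] := fg n.
  have mg : measurable (\bigcup_n g n : set BX) by exact: bigcup_measurable.
  have mD : measurable (\bigcup_n g n `\` \bigcup_n f n : set BX).
    by apply: measurableD => //; exact: bigcup_measurable.
  have small : m (\bigcup_n g n `\` \bigcup_n f n) <= (e / 2)%:E.
    apply: (@le_trans _ _ (\sum_(n <oo) m (g n `\` f n))).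
      apply: measure_sigma_subadditive => //.
      - by move=> n; exact: measurableD.
      - move=> x [[n _ gx] fx]; exists n => //; split => // fnx.
        by apply: fx; exists n.
    apply: le_trans (epsilon_trick0 xpredT (ltW e20)).
    by apply: lee_nneseries => // n _; have [] := fg n.
  (* A countable union of closed sets need not be closed. It is cut to a finite union, and
     continuity from above makes the additional loss small. *)
  pose F N := \bigcup_n g n `\` \big[setU/set0]_(i < N) f i.
  have FE : \bigcap_N F N = \bigcup_n g n `\` \bigcup_n f n.
    apply/seteqP; split => x.
      move=> Fx; split; first by have [] := Fx 0%N I.
      move=> [n _ fx]; have [_] := Fx n.+1 I; apply.
      by rewrite -bigcup_mkord; exists n => /=.
    move=> [gx fx] N _; split => //; rewrite -bigcup_mkord => -[i _ fi].
    by apply: fx; exists i.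
  have mF n : measurable (F n : set BX).
    by apply: measurableD => //; apply: bigsetU_measurable.
  have := @nonincreasing_cvg_mu _ BX R m F.
  rewrite FE => /(_ (fin _ (mF 0%N)) mF mD).
  have ni : nonincreasing_seq F.
    move=> a b ab; apply/subsetPset; apply: setDS; exact: subset_bigsetU.
  move=> /(_ ni) cvgF.
  have [N mFN] : exists N, m (F N) <= e%:E.
    have lt : m (\bigcup_n g n `\` \bigcup_n f n) < e%:E.
      by apply: (le_lt_trans small); rewrite lte_fin; lra.
    have /cvgF [N _ hN] : nbhs (m (\bigcup_n g n `\` \bigcup_n f n)) [set y | y < e%:E].
      by apply: open_nbhs_nbhs; split => //; exact: open_ereal_lt_ereal.
    by exists N; apply: ltW; apply: hN => /=.
  exists (\big[setU/set0]_(i < N) f i), (\bigcup_n g n); split => //.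
  + by apply: closed_bigsetU => i _; have [] := fg i.
  + by apply: bigcup_open => i _; have [] := fg i.
  + rewrite -bigcup_mkord; apply: subset_trans (_ : \bigcup_n f n `<=` _).
      by apply: bigcup_subset => // .
    by apply: subset_bigcup => i _; have [] := fg i.
  + by apply: subset_bigcup => i _; have [] := fg i.
Qed.

(** The criterion by which the measures constructed below are shown to be Radon: the squeeze between
    closed and open sets provides outer regularity, so only open sets have to be filled by compact
    ones. *)
Lemma finite_radonP m : m setT < +oo ->
  (forall U : set X, open U -> inner_regular m U) -> finite_radon m.
Proof.
move=> mT inn; split => //; split.
- move=> K cK; rewrite (le_lt_trans _ mT)//; apply: le_meas => //.
  exact: compact_borel.
- move=> E mE; apply/eqP; rewrite eq_le; apply/andP; split.
    apply: le_ereal_inf_tmp => _ [U [oU EU] <-]; apply: le_meas => //.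
    exact: open_borel.
  apply/lee_addgt0Pr => e e0.
  have [F [U [cF oU FE EU mUF]]] := finite_closed_open_approx mT inn mE e0.
  have mU := open_borel oU; have mF := closed_borel cF.
  apply: (@le_trans _ _ (m U)); first by apply: ereal_inf_lbound; exists U.
  rewrite -(setDUK (subset_trans FE EU)).
  rewrite (le_trans (measureU2 _ _ _))//; first exact: measurableD.
  by apply: leeD => //; exact: le_meas.
- move=> U oU; apply/eqP; rewrite eq_le; apply/andP; split; last first.
    apply: ge_ereal_sup => _ [K [cK KU] <-].
    by apply: le_meas => //; [exact: compact_borel|exact: open_borel].
  apply/lee_addgt0Pr => e e0.
  have [K [cK KU mK]] := inn U oU _ e0.
  have mU := open_borel oU; have mKb := compact_borel hX cK.
  rewrite -{1}(setDUK KU).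
  rewrite (le_trans (measureU2 _ _ _))//; first exact: measurableD.
  by apply: leeD => //; apply: ereal_sup_ubound; exists K.
Qed.

(** Meant for the Jordan parts of a difference of Radon measures, and for restrictions. *)
Lemma le_finite_radon m1 m2 : finite_radon m2 ->
  (forall E : set BX, measurable E -> m1 E <= m2 E) -> finite_radon m1.
Proof.
move=> m2R m12; apply: finite_radonP.
  by apply: le_lt_trans (m12 _ _) _ => //; exact: m2R.1.
move=> U oU e e0.
have [K [cK KU mK]] := finite_radon_inner m2R (open_borel oU) e0.
exists K; split => //; apply: le_trans mK; apply: m12.
by apply: measurableD; [exact: open_borel|exact: compact_borel].
Qed.

Lemma msum_finite_radon (m : {measure set BX -> \bar R}^nat) n :
  (forall i, finite_radon (m i)) -> finite_radon (msum m n).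
Proof.
move=> mR; apply: finite_radonP.
  by rewrite /msum/=; apply: lte_sum_pinfty => i _; exact: (mR i).1.
move=> U oU.
elim: n => [|n IHn] e e0.
  exists set0; split => //; first exact: compact0.
  by rewrite /= /msum big_ord0 lee_fin ltW.
have e20 : (0 < e / 2)%R by rewrite divr_gt0.
have mU := open_borel oU.
have [K [cK KU mK]] := IHn _ e20.
have [L [cL LU mL]] := finite_radon_inner (mR n) mU e20.
have mKb := compact_borel hX cK; have mLb := compact_borel hX cL.
exists (K `|` L); split; [exact: compactU|by rewrite subUset|].
rewrite /= /msum big_ord_recr/= [e]splitr EFinD; apply: leeD.
  apply: le_trans mK; rewrite /= /msum; apply: lee_sum => i _.
  apply: le_meas; [apply: measurableD => //; exact: measurableU|exact: measurableD|].
  by apply: setDS; exact: subsetUl.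
apply: le_trans mL; apply: le_meas;
  [apply: measurableD => //; exact: measurableU|exact: measurableD|].
by apply: setDS; exact: subsetUr.
Qed.

End regularity.

Lemma image_finite_radon (R : realType) (X Y : ptopologicalType)
    (m : {measure set (borel X) -> \bar R}) (f : X -> Y)
    (mf : measurable_fun [set: borel X] (f : borel X -> borel Y)) :
  hausdorff_space X -> hausdorff_space Y -> continuous f ->
  finite_radon m -> finite_radon (image_measure m mf).
Proof.
move=> hX hY cf mR; apply: finite_radonP => //.
  by rewrite /image_measure /= /pushforward preimage_setT; exact: mR.1.
move=> U oU e e0.
have oV : open (f @^-1` U) by move/continuousP : cf; exact.
have [K [cK KU mK]] := finite_radon_inner hX mR (open_borel oV) e0.
have cfK : compact (f @` K).
  by apply: continuous_compact => //; apply: continuous_subspaceT.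
exists (f @` K); split => //.
  by move=> _ [x Kx <-]; exact: KU.
apply: le_trans mK; rewrite /= /pushforward; apply: le_meas => //.
- change (measurable ((f @^-1` U) `\` (f @^-1` (f @` K)) : set (borel X))).
  apply: measurableD; first exact: open_borel.
  rewrite -[X in measurable X]setTI; apply: mf => //; exact: compact_borel.
- by apply: measurableD; [exact: open_borel|exact: compact_borel].
- by move=> x [Ux fKx]; split => // Kx; apply: fKx; exists x.
Qed.

(** * Mixtures *)

Section mixture.
Local Open Scope ereal_scope.
Context {R : realType} {X Z : ptopologicalType}.
Hypotheses (hX : hausdorff_space X) (hZ : hausdorff_space Z).
Hypothesis lZ : locally_compact [set: Z].
Variables (sigma : {measure set (borel X) -> \bar R})
  (k : X -> {measure set (borel Z) -> \bar R}) (C : R).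
Hypothesis sigmaR : finite_radon sigma.
Hypothesis kR : forall q, finite_radon (k q).
Hypothesis kC : forall q, k q setT <= C%:E.
Hypothesis klsc : forall U : set Z, open U ->
  forall t : R, open [set q | t%:E < k q U].

Let k_fin q (E : set (borel Z)) : measurable E -> k q E \is a fin_num.
Proof.
move=> mE; rewrite ge0_fin_numE//.
by apply: le_lt_trans (le_lt_trans (kC q) (ltry _)); exact: le_meas.
Qed.

(** The open sets are stable under intersection and generate the Borel sets, so a Dynkin argument
    applies; complements are handled by subtraction because each [k q] is finite. *)
Lemma measurable_lsc_kernel (E : set (borel Z)) : measurable E ->
  measurable_fun [set: borel X] (fun q => k q E).
Proof.
apply: (@dynkin_induction _ (borel Z) (@open Z)
    (fun E => measurable_fun [set: borel X] (fun q => k q E))) => //.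
- by move=> A B; exact: openI.
- by apply: lsc_borel; apply: klsc; exact: openT.
- by move=> U oU; apply: lsc_borel; exact: klsc.
- move=> S mS mkS.
  rewrite (_ : (fun q => _) = (fun q => k q setT - k q S)).
    apply: emeasurable_funB => //.
    by apply: lsc_borel; apply: klsc; exact: openT.
  apply/funext => q; rewrite -setTD measureD//; first by rewrite setTI.
  exact: (kR q).1.
- move=> F mF tF mkF.
  rewrite (_ : (fun q => _) = (fun q => \sum_(0 <= i <oo | i \in xpredT) k q (F i))).
    by apply: ge0_emeasurable_sum.
  apply/funext => q; rewrite measure_bigcup//.
  by apply: eq_eseriesl => i; rewrite in_setT.
Qed.

(** The mixture is a composition of two finite kernels: [sigma] as a kernel out of [unit], then [k]
    ignoring that coordinate. Its integration formula is the one for composed kernels. *)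
Let kcst (_ : unit) : {measure set (borel X) -> \bar R} := sigma.
Let kpar (p : unit * borel X) : {measure set (borel Z) -> \bar R} := k p.2.

Let measurable_kcst U : measurable U -> measurable_fun setT (kcst ^~ U).
Proof. by move=> mU; exact: measurable_cst. Qed.

HB.instance Definition _ := isKernel.Build _ _ unit (borel X) R kcst measurable_kcst.

Let kcst_uub : measure_fam_uub kcst.
Proof.
exists (fine (sigma setT) + 1)%R => u; rewrite /kcst EFinD fineK.
  by rewrite lteDl// ge0_fin_numE//; exact: sigmaR.1.
by rewrite ge0_fin_numE//; exact: sigmaR.1.
Qed.

HB.instance Definition _ := Kernel_isFinite.Build _ _ unit (borel X) R kcst kcst_uub.

Let measurable_kpar U : measurable U -> measurable_fun setT (kpar ^~ U).
Proof.
by move=> mU; exact: measurableT_comp (measurable_lsc_kernel mU) measurable_snd.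
Qed.

HB.instance Definition _ :=
  isKernel.Build _ _ (unit * borel X)%type (borel Z) R kpar measurable_kpar.

Let kpar_uub : measure_fam_uub kpar.
Proof.
by exists (C + 1)%R => p; apply: le_lt_trans (kC _) _; rewrite lte_fin ltrDl.
Qed.

HB.instance Definition _ :=
  Kernel_isFinite.Build _ _ (unit * borel X)%type (borel Z) R kpar kpar_uub.

Let mix : {measure set (borel Z) -> \bar R} := mkcomp kcst kpar tt.

Let mixE E : mix E = \int[sigma]_q k q E. Proof. by []. Qed.

Let integral_mix (f : borel Z -> \bar R) : (forall z, 0 <= f z) ->
  measurable_fun [set: borel Z] f ->
  \int[mix]_z f z = \int[sigma]_q \int[k q]_z f z.
Proof. by move=> f0 mf; exact: integral_kcomp. Qed.

Let C_ge0 : (0 <= C)%R.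
Proof. by rewrite -lee_fin; apply: le_trans (kC point). Qed.

(* Cut [X] into the layers where [k q U] exceeds the multiples of [d]. Each
   layer is open, hence nearly filled by a compact set, over which finitely many
   relatively compact open subsets of [U] carry that much mass; the closures of
   all these sets form the required compact subset of [U]. *)
Let mix_inner (U : set Z) : open U -> inner_regular mix U.
Proof.
move=> oU e e0.
have sT : sigma setT \is a fin_num by rewrite ge0_fin_numE//; exact: sigmaR.1.
pose S := fine (sigma setT).
have S0 : (0 <= S)%R by exact: fine_ge0.
(* [d] is the height of a layer: [2 * d] is the loss allowed at each [q], and [2 * d * S <= e / 2].
   The [n] layers reach above the bound [C] of all masses. The parts of the layers missed by their
   compact sets have total mass at most [n * e'], and [C] times this is at most [e / 2]. Adding 1 to
   [S] and [C] keeps the denominators positive. *)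
pose d := (e / (4 * (S + 1)))%R.
have d0 : (0 < d)%R by rewrite divr_gt0// mulr_gt0// ltr_wpDl.
pose n := (Num.truncn (C / d)).+1.
have Cn : (C < n%:R * d)%R by rewrite -ltr_pdivrMr// truncnS_gt.
pose e' := (e / (2 * (C + 1) * n%:R))%R.
have e'0 : (0 < e')%R by rewrite divr_gt0// !mulr_gt0// ltr_wpDl.
pose G j := [set q | (j%:R * d)%:E < k q U].
have oG j : open (G j) by exact: klsc.
have mG j : measurable (G j : set (borel X)) by exact: open_borel.
have /choice[K HK] j := finite_radon_inner hX sigmaR (mG j) e'0.
have mK j : measurable (K j : set (borel X)).
  by apply: compact_borel => //; have [] := HK j.
have /choice[V HV] j : exists V : set Z, [/\ open V, compact (closure V),
    closure V `<=` U & forall q, K j q -> (j%:R * d)%:E < k q V].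
  have [cK KG _] := HK j.
  have [||q Kq|W [_ KW [V [oV cV VU WV]]]] := @compact_induction X (K j)
    (fun W => exists V : set Z, [/\ open V, compact (closure V),
      closure V `<=` U & forall q, W q -> (j%:R * d)%:E < k q V]) cK.
  - exists set0; split => //; first exact: open0.
      by rewrite closure0; exact: compact0.
    by rewrite closure0.
  - move=> A B _ _ [V1 [oV1 cV1 VU1 AV1]] [V2 [oV2 cV2 VU2 BV2]].
    have mV1 := open_borel oV1; have mV2 := open_borel oV2.
    exists (V1 `|` V2); split; first exact: openU.
    + by rewrite closureU; exact: compactU.
    + by rewrite closureU subUset.
    + move=> q [/AV1|/BV2] /lt_le_trans; apply; apply: le_meas => //;
        by [exact: measurableU|move=> ?; left|move=> ?; right].
  - have [L [cL LU kL]] : exists L : set Z,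
        [/\ compact L, L `<=` U & (j%:R * d)%:E < k q L].
      have mU := open_borel oU.
      have Gq : (j%:R * d)%:E < k q U by exact: KG.
      exact: finite_radon_lt.
    have [V [oV LV cV VU]] := compact_open_between hZ lZ cL oU LU.
    exists [set q | (j%:R * d)%:E < k q V]; split; first exact: klsc.
      apply: (lt_le_trans kL); apply: le_meas => //.
      + exact: compact_borel.
      + exact: open_borel.
    by exists V.
  - by exists V; split => // q /KW/WV.
pose L := \big[setU/set0]_(j < n) closure (V j).
have cL : compact L by apply: bigsetU_compact => j _; have [] := HV j.
have mL := compact_borel hZ cL.
have mU := open_borel oU.
have mUL : measurable (U `\` L : set (borel Z)) by exact: measurableD.
have LU : L `<=` U.
  rewrite /L -(bigcup_mkord n (fun j => closure (V j))).
  by apply: bigcup_sub => j _; have [] := HV j.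
pose B := \big[setU/set0]_(j < n) (G j `\` K j).
have mB : measurable (B : set (borel X)).
  by apply: bigsetU_measurable => j _; exact: measurableD.
have sB : sigma B <= (e' *+ n)%:E.
  apply: (@le_trans _ _ (\sum_(j < n) sigma (G j `\` K j))).
    have := @content_subadditive _ _ _ sigma B (fun j => G j `\` K j) n.
    apply => // j _.
    exact: measurableD.
  apply: (@le_trans _ _ (\sum_(j < n) e'%:E)).
    by apply: lee_sum => j _; have [] := HK j.
  by rewrite sumEFin sumr_const card_ord.
have key q : k q (U `\` L) <= (2 * d)%:E + C%:E * (\1_B q)%:E.
  have [Bq|Bq] := pselect (B q).
    rewrite indicE mem_set// mule1.
    apply: (@le_trans _ _ C%:E).
      by apply: le_trans (kC q); exact: le_meas.
    by rewrite -EFinD lee_fin lerDr mulr_ge0// ltW.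
  rewrite indicE memNset// mule0 adde0.
  have kU := k_fin q mU; have kL := k_fin q mL.
  pose F := fine (k q U).
  have FE : k q U = F%:E by rewrite fineK.
  have F0 : (0 <= F)%R by exact: fine_ge0.
  have FC : (F <= C)%R.
    by rewrite -lee_fin -FE; apply: le_trans (kC q); exact: le_meas.
  have /truncn_itv/andP[] : (0 <= F / d)%R by rewrite divr_ge0// ltW.
  rewrite ler_pdivlMr// ltr_pdivrMr//.
  (* Since [G j] asks for a strict inequality, the layer used is the one just below the integer part
     of [F / d]. Hence [F] is below [(j + 2) * d], and the loss is below [2 * d]. *)
  case: (Num.truncn _) => [_ F1|j jF jF1].
    apply: (@le_trans _ _ (k q U)); first by apply: le_meas => //; exact: subDsetl.
    rewrite FE lee_fin; move: F1; rewrite mul1r => F1; lra.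
  have Gq : G j q.
    rewrite /G/= FE lte_fin; apply: lt_le_trans jF.
    by rewrite ltr_pM2r// ltr_nat.
  have jn : (j < n)%N.
    rewrite -(@ltr_nat R) -(@ltr_pM2r _ d)//; apply: le_lt_trans Cn.
    apply: le_trans FC; apply: le_trans jF.
    by rewrite ler_pM2r// ler_nat.
  have Kq : K j q.
    apply: contrapT => nKq; apply: Bq.
    rewrite /B -(bigcup_mkord n (fun j => G j `\` K j)).
    by exists j.
  have kVL : (j%:R * d)%:E < k q L.
    have [oV cV VU KV] := HV j.
    apply: lt_le_trans (KV q Kq) _; apply: le_meas => //; first exact: open_borel.
    move=> z Vz; rewrite /L -(bigcup_mkord n (fun j => closure (V j))).
    by exists j => //; exact: subset_closure.
  rewrite measDsub//; last by rewrite ltey_eq kU.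
  rewrite FE -(fineK kL) -EFinB lee_fin.
  move: kVL jF1; rewrite -(fineK kL) lte_fin -(addn2 j) natrD mulrDl.
  by move=> /= ? ?; lra.
exists L; split => //.
have kmes E : measurable E -> measurable_fun [set: borel X] (fun q => k q E).
  exact: measurable_lsc_kernel.
rewrite mixE.
apply: (@le_trans _ _ (\int[sigma]_q ((2 * d)%:E + C%:E * (\1_B q)%:E))).
  apply: ge0_le_integral => //.
  - exact: kmes.
  - apply: emeasurable_funD => //; apply: measurable_funeM.
    by apply/measurable_EFinP; exact: measurable_indic.
have mI : measurable_fun [set: borel X] (fun q : borel X => (\1_B q : R)%:E).
  by apply/measurable_EFinP; exact: measurable_indic.
rewrite ge0_integralD//; last 3 first.
  - by move=> q _; rewrite lee_fin mulr_ge0// ltW.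
  - by move=> q _; rewrite mule_ge0// lee_fin.
  - exact: measurable_funeM.
rewrite integral_cst// ge0_integralZl//; try by move=> q _; rewrite lee_fin.
rewrite integral_indic// setIT.
apply: (@le_trans _ _ ((2 * d)%:E * S%:E + C%:E * (e' *+ n)%:E)).
  apply: leeD; first by rewrite /S fineK.
  by apply: lee_pmul.
rewrite -!EFinM -EFinD lee_fin.
have -> : (e' *+ n = e / (2 * (C + 1)))%R.
  rewrite -[LHS]mulr_natr /e'.
  by field; rewrite pnatr_eq0 /= gt_eqF// ltr_wpDl.
have S1 : (2 * d * S <= e / 2)%R.
  rewrite /d (_ : (2 * _ * _ = e / 2 * (S / (S + 1)))%R); last first.
    by field; rewrite gt_eqF// ltr_wpDl.
  rewrite ler_piMr// ?divr_ge0// ?ltW//.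
  by rewrite ltr_pdivrMr ?mul1r ?ltrDl// ltr_wpDl.
have C1 : (C * (e / (2 * (C + 1))) <= e / 2)%R.
  rewrite (_ : (C * _ = e / 2 * (C / (C + 1)))%R); last first.
    by field; rewrite gt_eqF// ltr_wpDl.
  rewrite ler_piMr// ?divr_ge0// ?ltW//.
  by rewrite ltr_pdivrMr ?mul1r ?ltrDl// ltr_wpDl.
by lra.
Qed.

Lemma mixture_ex : exists m : {measure set (borel Z) -> \bar R},
  [/\ finite_radon m,
      forall E, measurable E -> m E = \int[sigma]_q k q E &
      forall f : borel Z -> \bar R, (forall z, 0 <= f z) ->
        measurable_fun [set: borel Z] f ->
        \int[m]_z f z = \int[sigma]_q \int[k q]_z f z].
Proof.
exists mix; split => //.
apply: finite_radonP => //.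
rewrite mixE; apply: (@le_lt_trans _ _ (\int[sigma]_q C%:E)).
  apply: ge0_le_integral => //; first exact: measurable_lsc_kernel.
rewrite integral_cst// ltey_eq fin_numM// ge0_fin_numE//; exact: sigmaR.1.
Qed.

End mixture.

(** * Integrals of bounded complex functions *)

Section bounded_borel.
Context {R : realType} {X : ptopologicalType}.
Implicit Type m : {measure set (borel X) -> \bar R}.

(** A class larger than the continuous functions of compact support and stable under integration
    against a bounded kernel. The inner integral of a convolution remains in it, although that
    integral need not have compact support. *)
Definition bounded_borel (f : X -> R) :=
  measurable_fun [set: borel X] (f : borel X -> R) /\
  exists C, forall x, `|f x| <= C.

Lemma bounded_borel_integrable m f : (m setT < +oo)%E -> bounded_borel f ->
  m.-integrable [set: borel X] (EFin \o f).
Proof.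
move=> mT [mf [C fC]]; apply: measurable_bounded_integrable => //.
exists C; split; first exact: num_real.
by move=> M CM x _; apply: le_trans (ltW CM).
Qed.

Lemma bounded_borel_cst (c : R) : bounded_borel (fun=> c).
Proof. by split => //; exists `|c|. Qed.

Lemma bounded_borelD f g : bounded_borel f -> bounded_borel g ->
  bounded_borel (fun x => f x + g x).
Proof.
move=> [mf [C fC]] [mg [D gD]]; split; first exact: measurable_funD.
by exists (C + D) => x; apply: le_trans (ler_normD _ _) _; exact: lerD.
Qed.

Lemma bounded_borelZ c f : bounded_borel f -> bounded_borel (fun x => c * f x).
Proof.
move=> [mf [C fC]]; split; first exact: measurable_funM.
by exists (`|c| * C) => x; rewrite normrM ler_wpM2l.
Qed.

Lemma bounded_borelB f g : bounded_borel f -> bounded_borel g ->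
  bounded_borel (fun x => f x - g x).
Proof.
move=> bf /(bounded_borelZ (-1)) bg.
rewrite (_ : (fun x => _) = (fun x => f x + -1 * g x)); first exact: bounded_borelD.
by apply/funext => x; rewrite mulN1r.
Qed.

Lemma bounded_borel_ge0_integral m (f : X -> R) : (m setT < +oo)%E ->
  bounded_borel f -> (\int[m]_x f x)%:E = (\int[m]_x (f x)%:E)%E.
Proof.
move=> mT bf; rewrite /Rintegral fineK//; apply: integrable_fin_num => //.
exact: bounded_borel_integrable.
Qed.

End bounded_borel.

Lemma bounded_borel_comp (R : realType) (X Y : ptopologicalType) (f : Y -> R)
    (g : X -> Y) :
  bounded_borel f -> measurable_fun [set: borel X] (g : borel X -> borel Y) ->
  bounded_borel (f \o g).
Proof.
move=> [mf [C fC]] mg; split; first exact: measurableT_comp mf mg.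
by exists C => x; exact: fC.
Qed.

Lemma Rintegral_image (R : realType) (X Y : ptopologicalType)
    (m : {measure set (borel X) -> \bar R}) (g : X -> Y)
    (mg : measurable_fun [set: borel X] (g : borel X -> borel Y)) (f : Y -> R) :
  (m setT < +oo)%E -> bounded_borel f ->
  \int[image_measure m mg]_y f y = \int[m]_x f (g x).
Proof.
move=> mT bf; rewrite /Rintegral /image_measure integral_pushforward//.
- by apply/measurable_EFinP; exact: bf.1.
- by apply: bounded_borel_integrable => //; exact: bounded_borel_comp.
Qed.

Lemma Rintegral_msum (R : realType) (X : ptopologicalType)
    (m : {measure set (borel X) -> \bar R}^nat) n (f : X -> R) :
  (forall i, m i setT < +oo)%E -> bounded_borel f ->
  \int[msum m n]_x f x = \sum_(i < n) \int[m i]_x f x.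
Proof.
move=> mT bf; have mf : measurable_fun [set: borel X] (EFin \o f).
  by apply/measurable_EFinP; exact: bf.1.
elim: n => [|n IHn].
  rewrite big_ord0 /Rintegral (eq_measure_integral mzero).
    by rewrite integral_measure_zero.
  by move=> A _ _; rewrite /= msum_mzero.
rewrite big_ord_recr/= -IHn.
have fin k : (msum m k setT < +oo)%E.
  by rewrite /= /msum; apply: lte_sum_pinfty => i _.
apply: EFin_inj; rewrite EFinD.
rewrite (bounded_borel_ge0_integral (fin n.+1) bf).
rewrite (bounded_borel_ge0_integral (fin n) bf).
rewrite (bounded_borel_ge0_integral (mT n) bf).
have if1 := bounded_borel_integrable (fin n) bf.
have if2 := bounded_borel_integrable (mT n) bf.
rewrite -integral_measure_add//.
apply: eq_measure_integral => A mA _.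
by rewrite [RHS]measure_addE /= /msum big_ord_recr.
Qed.

Section mixture_integral.
Context {R : realType} {X Z : ptopologicalType}.
Variables (sigma : {measure set (borel X) -> \bar R})
  (k : X -> {measure set (borel Z) -> \bar R}) (C : R)
  (m : {measure set (borel Z) -> \bar R}).
Hypothesis sT : (sigma setT < +oo)%E.
Hypothesis mT : (m setT < +oo)%E.
Hypothesis kC : forall q, (k q setT <= C%:E)%E.
Hypothesis mk : forall E : set (borel Z), measurable E ->
  measurable_fun [set: borel X] (fun q => k q E).
Hypothesis mE : forall f : borel Z -> \bar R, (forall z, 0 <= f z)%E ->
  measurable_fun [set: borel Z] f ->
  (\int[m]_z f z = \int[sigma]_q \int[k q]_z f z)%E.

Let kT q : (k q setT < +oo)%E.
Proof. exact: le_lt_trans (kC q) (ltry _). Qed.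

Let C_ge0 : 0 <= C.
Proof. by rewrite -lee_fin; apply: le_trans (kC point). Qed.

Let mixture_ge0 (f : Z -> R) : (forall z, 0 <= f z) -> bounded_borel f ->
  bounded_borel (fun q => \int[k q]_z f z) /\
  \int[m]_z f z = \int[sigma]_q \int[k q]_z f z.
Proof.
move=> f0 bf; have mf : measurable_fun [set: borel Z] (EFin \o f).
  by apply/measurable_EFinP; exact: bf.1.
have bk : bounded_borel (fun q => \int[k q]_z f z).
  split.
    apply: measurableT_comp; first exact: fine_measurable.
    by apply: measurable_fun_integral_kernel => // z; rewrite lee_fin.
  have [D fD] := bf.2.
  exists (D * C) => q.
  have D0 : 0 <= D by apply: le_trans (fD point).
  rewrite ger0_norm; last exact: Rintegral_ge0.
  rewrite -lee_fin bounded_borel_ge0_integral//.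
  apply: (@le_trans _ _ (\int[k q]_z D%:E)%E).
    apply: ge0_le_integral => //; first by move=> z _; rewrite lee_fin.
    by move=> z _; rewrite lee_fin; apply: le_trans (fD z); rewrite ler_norm.
  by rewrite integral_cst// EFinM lee_pmul.
split => //; apply: EFin_inj.
rewrite !bounded_borel_ge0_integral// mE//.
by apply: eq_integral => q _; rewrite bounded_borel_ge0_integral.
Qed.

(** The formula for mixtures is available for nonnegative integrands; adding the bound [D] makes [f]
    nonnegative, and the constant is subtracted again on both sides. *)
Lemma mixture_Rintegral (f : Z -> R) : bounded_borel f ->
  bounded_borel (fun q => \int[k q]_z f z) /\
  \int[m]_z f z = \int[sigma]_q \int[k q]_z f z.
Proof.
move=> bf; have [D fD] := bf.2.
have D0 : 0 <= D by apply: le_trans (fD point).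
have bc := @bounded_borel_cst R Z D.
have bg := bounded_borelD bf bc.
have [|bg' gE] := mixture_ge0 _ bg.
  by move=> z; have := fD z; rewrite ler_norml; lra.
have [//|bc' cE] := mixture_ge0 _ bc.
have key (mu : {measure set (borel Z) -> \bar R}) : (mu setT < +oo)%E ->
    \int[mu]_z f z = \int[mu]_z (f z + D) - \int[mu]_z D.
  move=> muT; rewrite -RintegralB//.
  - by apply: eq_Rintegral => z _; rewrite addrK.
  - exact: bounded_borel_integrable.
  - exact: bounded_borel_integrable.
have kE : (fun q => \int[k q]_z f z) =
    (fun q => \int[k q]_z (f z + D) - \int[k q]_z D).
  by apply/funext => q; exact: key.
split; first by rewrite kE; exact: bounded_borelB.
rewrite key// gE cE -RintegralB//; last 2 first.
- exact: bounded_borel_integrable.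
- exact: bounded_borel_integrable.
by apply: eq_Rintegral => q _; rewrite [RHS]key.
Qed.

End mixture_integral.

Section complex_integral.
Context {R : realType} {X : ptopologicalType}.
Implicit Type m : {measure set (borel X) -> \bar R}.
Local Open Scope complex_scope.

Definition bounded_borelC (f : X -> R[i]) :=
  bounded_borel (fun x => complex.Re (f x)) /\
  bounded_borel (fun x => complex.Im (f x)).

Lemma ReD (z w : R[i]) : complex.Re (z + w) = complex.Re z + complex.Re w.
Proof. by case: z => a b; case: w. Qed.
Lemma ImD (z w : R[i]) : complex.Im (z + w) = complex.Im z + complex.Im w.
Proof. by case: z => a b; case: w. Qed.
Lemma ReB (z w : R[i]) : complex.Re (z - w) = complex.Re z - complex.Re w.
Proof. by case: z => a b; case: w. Qed.
Lemma ImB (z w : R[i]) : complex.Im (z - w) = complex.Im z - complex.Im w.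
Proof. by case: z => a b; case: w. Qed.
Lemma ReM (z w : R[i]) : complex.Re (z * w) =
  complex.Re z * complex.Re w - complex.Im z * complex.Im w.
Proof. by case: z => a b; case: w. Qed.
Lemma ImM (z w : R[i]) : complex.Im (z * w) =
  complex.Re z * complex.Im w + complex.Im z * complex.Re w.
Proof. by case: z => a b; case: w. Qed.
Lemma complex_ext (z w : R[i]) : complex.Re z = complex.Re w ->
  complex.Im z = complex.Im w -> z = w.
Proof. by case: z => a b; case: w => c d /= -> ->. Qed.

Lemma bounded_borelC0 : bounded_borelC (fun=> 0).
Proof. by split; exact: bounded_borel_cst. Qed.

Lemma bounded_borelCD f g : bounded_borelC f -> bounded_borelC g ->
  bounded_borelC (fun x => f x + g x).
Proof.
move=> [f1 f2] [g1 g2]; split.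
  by under eq_fun do rewrite ReD; exact: bounded_borelD.
by under eq_fun do rewrite ImD; exact: bounded_borelD.
Qed.

Lemma bounded_borelCZ c f : bounded_borelC f -> bounded_borelC (fun x => c * f x).
Proof.
move=> [f1 f2]; split.
  under eq_fun do rewrite ReM.
  by apply: bounded_borelB; exact: bounded_borelZ.
under eq_fun do rewrite ImM.
by apply: bounded_borelD; exact: bounded_borelZ.
Qed.

Lemma bounded_borelC_sum I (r : seq I) (c : I -> R[i]) (f : I -> X -> R[i]) :
  (forall i, bounded_borelC (f i)) ->
  bounded_borelC (fun x => \sum_(i <- r) c i * f i x).
Proof.
move=> bf; elim: r => [|i r IHr].
  by under eq_fun do rewrite big_nil; exact: bounded_borelC0.
under eq_fun do rewrite big_cons.
by apply: bounded_borelCD => //; exact: bounded_borelCZ.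
Qed.

Section fin.
Variable m : {measure set (borel X) -> \bar R}.
Hypothesis mT : (m setT < +oo)%E.

Lemma eq_integralC f g : f =1 g -> integralC m f = integralC m g.
Proof. by move=> fg; congr integralC; apply/funext. Qed.

Lemma integralC0 : integralC m (fun=> 0) = 0.
Proof. by apply: complex_ext; rewrite /= Rintegral_cst// mul0r. Qed.

Lemma integralCD f g : bounded_borelC f -> bounded_borelC g ->
  integralC m (fun x => f x + g x) = integralC m f + integralC m g.
Proof.
move=> [f1 f2] [g1 g2]; apply: complex_ext.
  rewrite ReD /= -RintegralD//; try exact: bounded_borel_integrable.
  by apply: eq_Rintegral => x _; rewrite ReD.
rewrite ImD /= -RintegralD//; try exact: bounded_borel_integrable.
by apply: eq_Rintegral => x _; rewrite ImD.
Qed.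

Lemma integralCZ c f : bounded_borelC f ->
  integralC m (fun x => c * f x) = c * integralC m f.
Proof.
move=> [f1 f2].
have i1 := bounded_borel_integrable mT f1.
have i2 := bounded_borel_integrable mT f2.
apply: complex_ext.
  rewrite ReM /= -!RintegralZl// -RintegralB//.
  - by apply: eq_Rintegral => x _; rewrite ReM.
  - by apply: bounded_borel_integrable => //; exact: bounded_borelZ.
  - by apply: bounded_borel_integrable => //; exact: bounded_borelZ.
rewrite ImM /= -!RintegralZl// -RintegralD//.
- by apply: eq_Rintegral => x _; rewrite ImM.
- by apply: bounded_borel_integrable => //; exact: bounded_borelZ.
- by apply: bounded_borel_integrable => //; exact: bounded_borelZ.
Qed.

Lemma integralC_sum I (r : seq I) (c : I -> R[i]) (f : I -> X -> R[i]) :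
  (forall i, bounded_borelC (f i)) ->
  integralC m (fun x => \sum_(i <- r) c i * f i x) =
  \sum_(i <- r) c i * integralC m (f i).
Proof.
move=> bf; elim: r => [|i r IHr].
  by rewrite big_nil -[RHS]integralC0; apply: eq_integralC => x; rewrite big_nil.
rewrite big_cons -IHr -integralCZ// -integralCD//.
- by apply: eq_integralC => x; rewrite big_cons.
- exact: bounded_borelCZ.
- exact: bounded_borelC_sum.
Qed.

End fin.
End complex_integral.

Lemma bounded_borelC_comp (R : realType) (X Y : ptopologicalType) (f : Y -> R[i])
    (g : X -> Y) :
  bounded_borelC f -> measurable_fun [set: borel X] (g : borel X -> borel Y) ->
  bounded_borelC (f \o g).
Proof.
by move=> [f1 f2] mg; split;
  [exact: bounded_borel_comp f1 mg|exact: bounded_borel_comp f2 mg].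
Qed.

Lemma integralC_image (R : realType) (X Y : ptopologicalType)
    (m : {measure set (borel X) -> \bar R}) (g : X -> Y)
    (mg : measurable_fun [set: borel X] (g : borel X -> borel Y)) (f : Y -> R[i]) :
  (m setT < +oo)%E -> bounded_borelC f ->
  integralC (image_measure m mg) f = integralC m (fun x => f (g x)).
Proof. by move=> mT [f1 f2]; apply: complex_ext => /=; exact: Rintegral_image. Qed.

Lemma integralC_msum (R : realType) (X : ptopologicalType)
    (m : {measure set (borel X) -> \bar R}^nat) n (f : X -> R[i]) :
  (forall i, m i setT < +oo)%E -> bounded_borelC f ->
  integralC (msum m n) f = \sum_(i < n) integralC (m i) f.
Proof.
move=> mT [f1 f2]; apply: complex_ext => /=; rewrite Rintegral_msum//.
  elim/big_rec2 : _ => // i y z _ ->; by rewrite ReD.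
elim/big_rec2 : _ => // i y z _ ->; by rewrite ImD.
Qed.

Section Cc.
Context {R : realType} {X : ptopologicalType}.
Local Open Scope complex_scope.

Lemma Re_continuous : continuous (@complex.Re R : R[i]^o -> R).
Proof.
move=> z A /nbhs_ballP[e /= e0 eA].
have zB : nbhs (z : R[i]^o) (ball (z : R[i]^o) e%:C).
  by apply: nbhsx_ballx; rewrite ltcR.
apply: (@filterS _ _ (nbhs_filter (z : R[i]^o)) _ _ _ zB) => w.
move=> zw; apply: eA; rewrite /ball /= -ltcR; apply: le_lt_trans zw.
by rewrite -ReB; exact: normc_ge_Re.
Qed.

Lemma Im_continuous : continuous (@complex.Im R : R[i]^o -> R).
Proof.
move=> z A /nbhs_ballP[e /= e0 eA].
have zB : nbhs (z : R[i]^o) (ball (z : R[i]^o) e%:C).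
  by apply: nbhsx_ballx; rewrite ltcR.
apply: (@filterS _ _ (nbhs_filter (z : R[i]^o)) _ _ _ zB) => w.
move=> zw; apply: eA; rewrite /ball /= -ltcR; apply: le_lt_trans zw.
by rewrite -ImB normc_def lecR -sqrtr_sqr ler_wsqrtr// lerDr sqr_ge0.
Qed.

Lemma real_complex_continuous : continuous (real_complex R : R -> R[i]^o).
Proof.
move=> x A /nbhs_ballP[e /= e0 eA].
have [e1 e10 Ee] : exists2 e1, 0 < e1 & e = e1%:C.
  case: e e0 {eA} => a b; rewrite ltcE /= => /andP[/eqP -> a0].
  by exists a.
have xB : nbhs x (ball x e1) by exact: nbhsx_ballx.
apply: (@filterS _ _ (nbhs_filter x) _ _ _ xB) => y; rewrite /ball /= => xy; apply: eA; rewrite /ball /=.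
rewrite Ee -rmorphB /= normc_def /= expr0n /= addr0 sqrtr_sqr.
by rewrite ltcR.
Qed.

Lemma compact_support_bounded_borel (f : X -> R) : continuous f ->
  compact (closure [set x | f x != 0]) -> bounded_borel f.
Proof.
move=> cf cK; split; first exact: continuous_borel_real.
have cfK : compact (f @` closure [set x | f x != 0]).
  by apply: continuous_compact => //; exact: continuous_subspaceT.
have [M [_ fM]] := compact_bounded cfK.
exists (`|M| + 1) => x.
have [->|fx] := eqVneq (f x) 0; first by rewrite normr0 addr_ge0.
apply: (fM (`|M| + 1)); first by rewrite ltr_pwDr// ler_norm.
by exists x => //; exact: subset_closure.
Qed.

Lemma Cc_bounded_borelC (f : X -> R[i]) : Cc f -> bounded_borelC f.
Proof.
move=> [cf cK]; split; apply: compact_support_bounded_borel.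
- move=> x; apply: (@continuous_comp _ R[i]^o _ f (@complex.Re R)); first exact: cf.
  exact: Re_continuous.
- apply: subclosed_compact cK _; first exact: closed_closure.
  by apply: closureS => x /=; apply: contra_neq => ->.
- move=> x; apply: (@continuous_comp _ R[i]^o _ f (@complex.Im R)); first exact: cf.
  exact: Im_continuous.
- apply: subclosed_compact cK _; first exact: closed_closure.
  by apply: closureS => x /=; apply: contra_neq => ->.
Qed.

Lemma real_Cc (f : X -> R) : continuous f ->
  compact (closure [set x | f x != 0]) -> Cc (fun x => (f x)%:C).
Proof.
move=> cf cK; split.
  move=> x; apply: (@continuous_comp _ _ R[i]^o f (real_complex R)); first exact: cf.
  exact: real_complex_continuous.
apply: subclosed_compact cK _; first exact: closed_closure.
by apply: closureS => x /=; apply: contra_neq => ->.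
Qed.

End Cc.

Section finite_restriction.
Context d (T : measurableType d) (R : realType).
Variable m : {measure set T -> \bar R}.

(* Copies of [m] carrying the finiteness proofs as canonical structures. *)
Definition finm of (m setT < +oo)%E : set T -> \bar R := m.

Section finm.
Hypothesis mT : (m setT < +oo)%E.
HB.instance Definition _ := Measure.on (finm mT).
Let finm_fin : fin_num_fun (finm mT).
Proof. exact: lty_fin_num_fun. Qed.
HB.instance Definition _ := Measure_isFinite.Build _ _ _ (finm mT) finm_fin.
End finm.

Definition sigfm of sigma_finite setT m : set T -> \bar R := m.

Section sigfm.
Hypothesis mS : sigma_finite setT m.
HB.instance Definition _ := Measure.on (sigfm mS).
HB.instance Definition _ := Measure_isSigmaFinite.Build _ _ _ (sigfm mS) mS.
End sigfm.

End finite_restriction.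

(** * Complex measures *)

Section pieces.
Local Open Scope ereal_scope.
Context {R : realType} {X : ptopologicalType}.
Local Notation BX := (borel X).
Implicit Types (nu : {charge set BX -> \bar R}) (m : {measure set BX -> \bar R}).

Lemma pos_part_fin nu : pos_part nu setT < +oo.
Proof. by rewrite ltey_eq fin_num_measure. Qed.

Lemma neg_part_fin nu : neg_part nu setT < +oo.
Proof. by rewrite ltey_eq fin_num_measure. Qed.

Lemma pos_part_eq nu : exists2 P : set BX, measurable P &
  forall E, measurable E -> pos_part nu E = nu (E `&` P).
Proof.
set h := svalP (hahn_ex nu); have [[mP _] _ _ _] := h.
exists (sval (hahn_ex nu)).1 => // E mE.
by rewrite [LHS]jordan_posE cjordan_posE /crestr0 mem_set.
Qed.

Lemma neg_part_eq nu : exists2 N : set BX, measurable N &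
  forall E, measurable E -> neg_part nu E = - nu (E `&` N).
Proof.
set h := svalP (hahn_ex nu); have [_ [mN _] _ _] := h.
exists (sval (hahn_ex nu)).2 => // E mE.
by rewrite [LHS]jordan_negE cjordan_negE /crestr0 mem_set.
Qed.

Lemma pos_neg_part nu E : measurable E -> nu E = pos_part nu E - neg_part nu E.
Proof.
move=> mE; have := jordan_decomp (svalP (hahn_ex nu)) mE.
rewrite /cadd => ->.
by congr (_ + _)%E; rewrite [LHS]mulN1e.
Qed.

Lemma pos_part_null nu (lam : {measure set BX -> \bar R}) :
  (forall E, measurable E -> lam E = 0 -> nu E = 0) ->
  forall E, measurable E -> lam E = 0 -> pos_part nu E = 0.
Proof.
move=> h E mE lE; have [P mP ->//] := pos_part_eq nu.
have mEP : measurable (E `&` P) by exact: measurableI.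
by apply: h => //; exact: subset_measure0 mEP mE (@subIsetl _ _ _) lE.
Qed.

Lemma neg_part_null nu (lam : {measure set BX -> \bar R}) :
  (forall E, measurable E -> lam E = 0 -> nu E = 0) ->
  forall E, measurable E -> lam E = 0 -> neg_part nu E = 0.
Proof.
move=> h E mE lE; have [P mP ->//] := neg_part_eq nu.
have mEP : measurable (E `&` P) by exact: measurableI.
by rewrite h ?oppe0//; exact: subset_measure0 mEP mE (@subIsetl _ _ _) lE.
Qed.

(* The four positive measures of the decomposition of a complex measure,
   indexed so that the n-th one comes with the coefficient ['i ^+ n]. *)
Definition piece (mu : cmeasure R X) (n : nat) : {measure set BX -> \bar R} :=
  match n with
  | 0%N => pos_part (cmre mu)
  | 1%N => pos_part (cmim mu)
  | 2%N => neg_part (cmre mu)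
  | _ => neg_part (cmim mu)
  end.

(** [piece] is constant from index 3 on, so statements over all indices reduce to the four genuine
    ones. *)
Lemma piece_minn mu n : piece mu n = piece mu (minn n 3).
Proof. by case: n => [|[|[|[|n]]]]. Qed.

Lemma piece_fin mu n : piece mu n setT < +oo.
Proof. by case: n => [|[|[|n]]]; [exact: pos_part_fin|exact: pos_part_fin|
  exact: neg_part_fin|exact: neg_part_fin]. Qed.

Lemma M_piece mu n : M R X mu -> radon (piece mu n).
Proof. by move=> [[r0 r2] [r1 r3]]; case: n => [|[|[|n]]]. Qed.

Lemma piece_M mu : (forall n, radon (piece mu n)) -> M R X mu.
Proof.
by move=> r; split; split; [exact: (r 0%N)|exact: (r 2%N)|exact: (r 1%N)|exact: (r 3%N)].
Qed.

Lemma piece_finite_radon mu n : M R X mu -> finite_radon (piece mu n).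
Proof. by move=> Mmu; split; [exact: piece_fin|exact: M_piece]. Qed.

Local Open Scope complex_scope.

Lemma cmintE mu (f : X -> R[i]) :
  (cmint mu f = \sum_(n < 4) 'i ^+ n * integralC (piece mu n) f)%R.
Proof.
rewrite /cmint /integral_charge !big_ord_recl big_ord0 /=.
rewrite addr0 expr0 mul1r expr1.
have -> : ('i ^+ 2 = -1 :> R[i])%R by exact: sqr_i.
have -> : ('i ^+ 3 = - 'i :> R[i])%R by rewrite exprS sqr_i mulrN1.
by ring.
Qed.

End pieces.

Section charge_difference.
Local Open Scope ereal_scope.
Context {R : realType} {X : ptopologicalType}.
Local Notation BX := (borel X).
Variables (nu : {charge set BX -> \bar R}) (m0 m1 : {measure set BX -> \bar R}).
Hypotheses (m0T : m0 setT < +oo) (m1T : m1 setT < +oo).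
Hypothesis nuE : forall E : set BX, measurable E -> nu E = m0 E - m1 E.

Let m_fin (m : {measure set BX -> \bar R}) E : m setT < +oo -> measurable E -> m E \is a fin_num.
Proof.
by move=> mT mE; rewrite ge0_fin_numE// (le_lt_trans _ mT)//; exact: le_meas.
Qed.

(** Minimality of the Jordan decomposition: on the positive Hahn set, [nu] is at most [m0] because
    [m1] is nonnegative. *)
Lemma pos_part_le E : measurable E -> pos_part nu E <= m0 E.
Proof.
move=> mE; have [P mP ->//] := pos_part_eq nu.
have mEP : measurable (E `&` P) by exact: measurableI.
rewrite nuE// (@le_trans _ _ (m0 (E `&` P)))//; last first.
  by apply: le_meas => //; exact: subIsetl.
by rewrite leeBlDr ?m_fin// leeDl.
Qed.

Lemma neg_part_le E : measurable E -> neg_part nu E <= m1 E.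
Proof.
move=> mE; have [P mP ->//] := neg_part_eq nu.
have mEP : measurable (E `&` P) by exact: measurableI.
rewrite nuE// (@le_trans _ _ (m1 (E `&` P)))//; last first.
  by apply: le_meas => //; exact: subIsetl.
rewrite -(fineK (m_fin m0T mEP)) -(fineK (m_fin m1T mEP)) -EFinB -EFinN lee_fin.
by rewrite opprB lerBlDr lerDl fine_ge0.
Qed.

(** Moving the negative terms across gives [pos_part nu + m1 = m0 + neg_part nu], an equality of
    positive measures; the sums are taken as two-term [msum]s. *)
Lemma integral_charge_diff (f : X -> R[i]) : bounded_borelC f ->
  (integral_charge nu f = integralC m0 f - integralC m1 f)%R.
Proof.
move=> bf; apply/eqP; rewrite /integral_charge subr_eq addrAC eq_sym subr_eq eq_sym; apply/eqP.
pose s (a b : {measure set BX -> \bar R}) (i : nat) := if i is 0%N then a else b.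
have sE (a b : {measure set BX -> \bar R}) A : msum (s a b) 2 A = a A + b A.
  by rewrite /= /msum !big_ord_recl big_ord0 addr0.
have pT := pos_part_fin nu; have nT := neg_part_fin nu.
have add (a b : {measure set BX -> \bar R}) : a setT < +oo -> b setT < +oo ->
    (integralC (msum (s a b) 2) f = integralC a f + integralC b f)%R.
  move=> aT bT; rewrite integralC_msum//; first by rewrite !big_ord_recl big_ord0 addr0.
  by case.
rewrite -!add//; apply: complex_ext; rewrite /= /Rintegral; congr fine;
  apply: eq_measure_integral => A mA _; rewrite [LHS]sE [RHS]sE.
all: have := pos_neg_part nu mA; rewrite nuE//.
all: have := m_fin m0T mA; have := m_fin m1T mA; have := m_fin pT mA; have := m_fin nT mA.
all: move: (pos_part nu A) (neg_part nu A) (m0 A) (m1 A).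
all: move=> [a||]//[b||]//[c||]//[e||]// _ _ _ _.
all: by rewrite -!EFinB -!EFinD => -[h]; congr EFin; lra.
Qed.

End charge_difference.

Section combination.
Local Open Scope ereal_scope.
Context {R : realType} {X : ptopologicalType}.
Local Notation BX := (borel X).
Hypothesis hX : hausdorff_space X.
Local Open Scope complex_scope.

(** The pieces are only bounded by the given measures: mass common to [m 0] and [m 2], or to [m 1]
    and [m 3], cancels in the Jordan decomposition. *)
Lemma cmeasure_of_pieces (m : {measure set BX -> \bar R}^nat) :
  (forall n, finite_radon (m n)) ->
  exists mu : cmeasure R X, [/\ M R X mu,
    forall (n : nat) E, (n < 4)%N -> measurable E -> piece mu n E <= m n E &
    forall f, bounded_borelC f ->
      (cmint mu f = \sum_(n < 4) 'i ^+ n * integralC (m n) f)%R].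
Proof.
move=> mR; have mT n : m n setT < +oo by exact: (mR n).1.
pose ch (a b : nat) : {charge set BX -> \bar R} :=
  cadd (charge_of_finite_measure (finm (mT a)))
       (cscale (-1) (charge_of_finite_measure (finm (mT b)))).
have chE a b E : measurable E -> ch a b E = m a E - m b E.
  by move=> mE; congr (_ + _); rewrite [LHS]mulN1e.
pose mu := CMeasure (ch 0%N 2%N) (ch 1%N 3%N).
have le n E : (n < 4)%N -> measurable E -> piece mu n E <= m n E.
  move: n => [|[|[|[|//]]]] _ mE /=.
  - by apply: (pos_part_le (m1 := m 2%N)) => //; exact: chE.
  - by apply: (pos_part_le (m1 := m 3%N)) => //; exact: chE.
  - by apply: (neg_part_le (m0 := m 0%N)) => //; exact: chE.
  - by apply: (neg_part_le (m0 := m 1%N)) => //; exact: chE.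
exists mu; split => //.
  apply: piece_M => n.
  rewrite piece_minn; apply: (le_finite_radon hX (mR (minn n 3)) _).2 => E.
  by apply: le; rewrite ltnS geq_minr.
move=> f bf; rewrite /cmint /=.
rewrite (integral_charge_diff (mT 0%N) (mT 2%N) (chE _ _))//.
rewrite (integral_charge_diff (mT 1%N) (mT 3%N) (chE _ _))//.
rewrite !big_ord_recl big_ord0 /=.
rewrite addr0 expr0 mul1r expr1.
have -> : ('i ^+ 2 = -1 :> R[i])%R by exact: sqr_i.
have -> : ('i ^+ 3 = - 'i :> R[i])%R by rewrite exprS sqr_i mulrN1.
by ring.
Qed.

End combination.

(** * Absolutely continuous measures *)

Section Lambda.
Local Open Scope ereal_scope.
Context {R : realType} {X : ptopologicalType}.
Local Notation BX := (borel X).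
Hypothesis hX : hausdorff_space X.
Variable lam : {measure set BX -> \bar R}.
Hypothesis lamR : radon lam.
Implicit Types (nu : {charge set BX -> \bar R}) (p : {measure set BX -> \bar R}).

(** For integrable [f] these increasing sets have finite measure, by Chebyshev's inequality, and
    they exhaust the set where [f] is nonzero. *)
Let level (f : X -> R) (n : nat) : set BX := [set x | (n.+1%:R^-1 <= `|f x|)%R].

Let measurable_level f n : measurable_fun [set: BX] (f : BX -> R) ->
  measurable (level f n).
Proof.
move=> mf; have mnf : measurable_fun [set: BX] (fun x => `|f x|%R).
  exact: measurableT_comp.
have := mnf measurableT _ (measurable_itv `[(n.+1%:R^-1 : R)%R, +oo[%R).
rewrite setTI; congr measurable; apply/seteqP; split => x /=;
  by rewrite in_itv/= andbT.
Qed.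

Let level_fin f n : lam.-integrable [set: BX] (EFin \o f) ->
  lam (level f n) < +oo.
Proof.
move=> /[dup] intf /integrableP[/measurable_EFinP mf ioo].
have mL := measurable_level n mf.
have n0 : (0 < n.+1%:R^-1 :> R)%R by rewrite invr_gt0.
suff : (n.+1%:R^-1)%:E * lam (level f n) < +oo.
  move: (lam (level f n)) (measure_ge0 lam (level f n)) => [r||]//= _; rewrite ?ltry//.
  by rewrite gt0_muley.
rewrite -integral_cst//; apply: le_lt_trans ioo.
apply: (@le_trans _ _ (\int[lam]_(x in level f n) `|(EFin \o f) x|)).
  apply: ge0_le_integral => //.
  - by move=> x _; rewrite lee_fin ltW.
  - apply: measurableT_comp => //; apply: measurable_funTS.
    exact/measurable_EFinP.
apply: ge0_subset_integral => //; apply: measurableT_comp => //.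
exact/measurable_EFinP.
Qed.

(* A finite measure absolutely continuous with respect to a Radon measure is
   Radon if it lives on countably many sets of finite measure: [lam] itself is
   only inner regular there. *)
Let radon_of_null p (S : nat -> set BX) : p setT < +oo ->
  (forall E, measurable E -> lam E = 0 -> p E = 0) ->
  (forall n, measurable (S n)) -> nondecreasing_seq S ->
  (forall n, lam (S n) < +oo) -> p (~` \bigcup_n S n) = 0 ->
  finite_radon p.
Proof.
move=> pT pnull mS ndS lS pS; apply: finite_radonP => // U oU e e0.
have mU := open_borel oU.
have e20 : (0 < e / 2)%R by rewrite divr_gt0.
have mUS n : measurable (U `\` S n : set BX) by exact: measurableD.
have mUSS : measurable (U `\` \bigcup_n S n : set BX).
  by apply: measurableD => //; exact: bigcup_measurable.
have capE : \bigcap_n (U `\` S n) = U `\` \bigcup_n S n.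
  apply/seteqP; split => x.
    move=> h; split; first by have [] := h 0%N I.
    by move=> [n _ Sx]; have [_] := h n I.
  by move=> [Ux Sx] n _; split => // ?; apply: Sx; exists n.
have p0 : p (U `\` \bigcup_n S n) = 0.
  have mSc : measurable (~` \bigcup_n S n : set BX).
    by apply: measurableC; exact: bigcup_measurable.
  by apply: (subset_measure0 mUSS mSc _ pS) => x [].
have [n pn] : exists n, p (U `\` S n) <= (e / 2)%:E.
  have ni : nonincreasing_seq (fun n => U `\` S n : set BX).
    by move=> a b ab; apply/subsetPset; apply: setDS; apply/subsetPset/ndS.
  have p0T : p (U `\` S 0%N) < +oo.
    by rewrite (le_lt_trans _ pT)//; exact: le_meas.
  have := @nonincreasing_cvg_mu _ BX R p (fun n => U `\` S n).
  rewrite capE => /(_ p0T mUS mUSS ni) cvgp.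
  have /cvgp [N _ hN] : nbhs (p (U `\` \bigcup_n S n)) [set y | y < (e / 2)%:E].
    apply: open_nbhs_nbhs; split; first exact: open_ereal_lt_ereal.
    by rewrite /= p0 lte_fin.
  by exists N; apply: ltW; apply: hN => /=.
have mUn : measurable (U `&` S n : set BX) by exact: measurableI.
(* Absolute continuity in its epsilon-delta form: it turns a compact set that fills [U] within [S n]
   up to small [lam]-measure into one that fills it up to small [p]-measure. *)
have [d [d0 hd]] : exists d : R, (0 < d)%R /\
    forall A : set BX, measurable A -> lam A < d%:E -> p A < (e / 2)%:E.
  pose nu : {charge set BX -> \bar R} := charge_of_finite_measure (finm pT).
  have nulam : nu `<< lam.
    by apply/null_content_dominatesP => A mA; exact: pnull.
  have [d [d0 hd]] := charge_variation_continuous (svalP (hahn_ex nu)) nulam e20.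
  exists d; split => // A mA lA; apply: le_lt_trans (hd A mA lA).
  have := abse_charge_variation (svalP (hahn_ex nu)) mA.
  by rewrite gee0_abs.
have lUS : lam (U `&` S n) < +oo.
  by rewrite (le_lt_trans _ (lS n))//; apply: le_meas => //; exact: subIsetr.
have d20 : (0 < d / 2)%R by rewrite divr_gt0.
have [K [cK KUS lK]] := radon_inner_regular hX lamR mUn lUS d20.
exists K; split => //; first by move=> x /KUS[].
have mK := compact_borel hX cK.
apply: (@le_trans _ _ (p ((U `\` S n) `|` ((U `&` S n) `\` K)))).
  apply: le_meas; first exact: measurableD.
    by apply: measurableU => //; exact: measurableD.
  move=> x [Ux Kx]; have [Sx|Sx] := pselect (S n x); first by right.
  by left.
rewrite (le_trans (measureU2 _ _ _))//; first exact: measurableD.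
rewrite [e]splitr EFinD leeD//; apply: ltW; apply: hd; first exact: measurableD.
by apply: le_lt_trans lK _; rewrite lte_fin; lra.
Qed.

Let null_density nu (f : X -> R) : lam.-integrable [set: BX] (EFin \o f) ->
  (forall E, measurable E -> nu E = \int[lam]_(x in E) (f x)%:E) ->
  forall E, measurable E -> lam E = 0 -> nu E = 0.
Proof.
move=> intf nuE E mE lE; rewrite nuE//; apply: null_set_integral => //.
by apply: measurable_funTS; exact: measurable_int intf.
Qed.

Let radon_density nu (f : X -> R) : lam.-integrable [set: BX] (EFin \o f) ->
  (forall E, measurable E -> nu E = \int[lam]_(x in E) (f x)%:E) ->
  radon_charge nu.
Proof.
move=> intf nuE.
have mf : measurable_fun [set: BX] (f : BX -> R).
  by apply/measurable_EFinP; exact: measurable_int intf.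
have nnull := null_density intf nuE.
have mS n := measurable_level n mf.
have ndS : nondecreasing_seq (level f).
  move=> a b ab; apply/subsetPset => x /=; apply: le_trans.
  by rewrite lef_pV2 ?posrE// ler_nat.
have zero E : measurable E -> E `<=` ~` (\bigcup_n level f n) -> nu E = 0.
  move=> mE ES; rewrite nuE//; apply: integral0_eq => x /ES Sx.
  have [->//|fx] := eqVneq (f x) 0%R.
  exfalso; apply: Sx; have fx0 : (0 < `|f x|)%R by rewrite normr_gt0.
  exists (Num.truncn `|f x|^-1) => //=.
  rewrite /level /= -[leRHS]invrK lef_pV2 ?posrE ?invr_gt0// ltW//.
  by rewrite truncnS_gt.
have mSc : measurable (~` \bigcup_n level f n : set BX).
  by apply: measurableC; exact: bigcup_measurable.
split.
- suff [] : finite_radon (pos_part nu) by [].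
  apply: (@radon_of_null _ (level f)) => //; first exact: pos_part_fin.
  + exact: pos_part_null.
  + by move=> n; exact: level_fin.
  + have [P mP ->//] := pos_part_eq nu; apply: zero; first exact: measurableI.
    exact: subIsetl.
- suff [] : finite_radon (neg_part nu) by [].
  apply: (@radon_of_null _ (level f)) => //; first exact: neg_part_fin.
  + exact: neg_part_null.
  + by move=> n; exact: level_fin.
  + have [P mP ->//] := neg_part_eq nu; rewrite zero ?oppe0//.
    exact: measurableI.
Qed.

Lemma Lambda_sub_M : Lambda lam `<=` M R X.
Proof.
move=> mu [phi mu_phi]; have [i1 i2] := L1_integrable phi; split.
  by apply: (radon_density i1) => E /mu_phi[].
by apply: (radon_density i2) => E /mu_phi[].
Qed.

Lemma Lambda_null mu n E : Lambda lam mu -> measurable E -> lam E = 0 ->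
  piece mu n E = 0.
Proof.
move=> [phi mu_phi]; have [i1 i2] := L1_integrable phi.
have n1 : forall E, measurable E -> lam E = 0 -> cmre mu E = 0.
  by apply: (null_density i1) => A /mu_phi[].
have n2 : forall E, measurable E -> lam E = 0 -> cmim mu E = 0.
  by apply: (null_density i2) => A /mu_phi[].
by case: n => [|[|[|n]]]; [exact: pos_part_null|exact: pos_part_null|
  exact: neg_part_null|exact: neg_part_null].
Qed.

Lemma Lambda_cm0 : Lambda lam cm0.
Proof.
have i0 : integrableC lam (fun=> 0%R).
  by split; exact: integrable0.
exists (MkL1 i0) => E mE.
by rewrite /= /induced_charge !integral0.
Qed.

Lemma Lambda_cmadd (mu nu : cmeasure R X) : Lambda lam mu -> Lambda lam nu ->
  Lambda lam (cmadd mu nu).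
Proof.
move=> [f mf] [g ng]; have [f1 f2] := L1_integrable f.
have [g1 g2] := L1_integrable g.
have ifg : integrableC lam (fun x => f x + g x)%R.
  split.
    move: (integrableD measurableT f1 g1); apply: eq_integrable => // x _.
    by rewrite ReD.
  move: (integrableD measurableT f2 g2); apply: eq_integrable => // x _.
  by rewrite ImD.
exists (MkL1 ifg) => E mE; have [mf1 mf2] := mf E mE; have [ng1 ng2] := ng E mE.
split; rewrite /= /cadd ?mf1 ?mf2 ?ng1 ?ng2 /= /induced_charge.
  rewrite -integralD//; [|exact: integrableS f1|exact: integrableS g1].
  by apply: eq_integral => x _; rewrite ReD.
rewrite -integralD//; [|exact: integrableS f2|exact: integrableS g2].
by apply: eq_integral => x _; rewrite ImD.
Qed.

Lemma Lambda_cmscale z mu : Lambda lam mu -> Lambda lam (cmscale z mu).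
Proof.
move=> [f mf]; have [f1 f2] := L1_integrable f.
have i c (h : X -> R) : lam.-integrable [set: BX] (fun x => (h x)%:E) ->
    lam.-integrable [set: BX] (fun x => c%:E * (h x)%:E).
  by move=> ih; exact: integrableZl.
have ifz : integrableC lam (fun x => z * f x)%R.
  split.
    move: (integrableD measurableT (i (complex.Re z) _ f1)
      (i (- complex.Im z)%R _ f2)); apply: eq_integrable => // x _.
    by rewrite ReM -!EFinM -EFinD mulNr.
  move: (integrableD measurableT (i (complex.Im z) _ f1)
      (i (complex.Re z)%R _ f2)); apply: eq_integrable => // x _.
  by rewrite ImM -!EFinM -EFinD addrC.
exists (MkL1 ifz) => E mE; have [mf1 mf2] := mf E mE.
have s1 := integrableS measurableT mE (@subsetT _ E) f1.
have s2 := integrableS measurableT mE (@subsetT _ E) f2.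
split; rewrite /= /cadd /= /cscale ?mf1 ?mf2 /= /induced_charge.
  rewrite -!integralZl// -integralD//; try exact: integrableZl.
  by apply: eq_integral => x _; rewrite ReM -!EFinM -EFinD mulNr.
rewrite -!integralZl// -integralD//; try exact: integrableZl.
by apply: eq_integral => x _; rewrite ImM -!EFinM -EFinD addrC.
Qed.

End Lambda.

Section Lambda_of_null.
Local Open Scope ereal_scope.
Context {R : realType} {X : ptopologicalType}.
Local Notation BX := (borel X).
Hypothesis hX : hausdorff_space X.

Lemma integrable_mrestr (lam : {measure set BX -> \bar R}) (S : set BX)
    (mS : measurable S) (g : BX -> \bar R) :
  (mrestr lam mS).-integrable [set: BX] g ->
  lam.-integrable [set: BX] (g \_ S) /\
  forall E, measurable E ->
    \int[mrestr lam mS]_(x in E) g x = \int[lam]_(x in E) (g \_ S) x.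
Proof.
move=> intg; have [mg goo] := integrableP _ _ _ intg.
have eqS (f : BX -> \bar R) (E : set BX) : measurable E ->
    \int[mrestr lam mS]_(x in E `&` S) f x = \int[lam]_(x in E `&` S) f x.
  move=> mE; apply: eq_measure_integral => A mA AES.
  by rewrite /= /mrestr setIidl// => x /AES[].
split.
  apply/(integrable_mkcond _ mS)/integrableP; split; first exact: measurable_funTS.
  rewrite -(setTI S) -eqS//; apply: le_lt_trans goo.
  apply: ge0_subset_integral => //; first exact: measurableI.
  exact: measurableT_comp.
move=> E mE.
have mSc : measurable (~` S) by exact: measurableC.
rewrite -integral_mkcondr -eqS//.
rewrite (negligible_integral (N := ~` S))//.
- by rewrite setDE setCK.
- exact: integrableS intg.
- by rewrite /= /mrestr setICl measure0.
Qed.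

Variable lam : {measure set BX -> \bar R}.
Hypothesis lamR : radon lam.

(* [lam] need not be sigma-finite, as Radon-Nikodym requires, but [mu] lives on a
   sigma-compact set [S], and the restriction of [lam] to [S] is. *)
Lemma Lambda_of_null (mu : cmeasure R X) : M R X mu ->
  (forall (n : nat) (K : set X), compact K -> lam K = 0 -> piece mu n K = 0) ->
  Lambda lam mu.
Proof.
move=> Mmu null; have pR n := piece_finite_radon n Mmu.
have /choice[C HC] i : exists C : set X, compact C /\
    forall n, piece mu n (~` C) <= (i.+1%:R^-1)%:E.
  have i0 : (0 < i.+1%:R^-1 :> R)%R by rewrite invr_gt0.
  have inn n := finite_radon_inner hX (pR n) measurableT i0.
  have [K0 [cK0 _ pK0]] := inn 0%N; have [K1 [cK1 _ pK1]] := inn 1%N.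
  have [K2 [cK2 _ pK2]] := inn 2%N; have [K3 [cK3 _ pK3]] := inn 3%N.
  (* All indices from 3 on give the same piece, so four compact sets serve every [n]. *)
  exists (K0 `|` K1 `|` (K2 `|` K3)); split; first by do 2?apply: compactU.
  have sub (p : {measure set BX -> \bar R}) (K L : set X) : compact K ->
      compact L -> K `<=` L -> p (setT `\` K) <= (i.+1%:R^-1)%:E ->
      p (~` L) <= (i.+1%:R^-1)%:E.
    move=> cK cL KL; apply: le_trans; rewrite setTD; apply: le_meas.
    - by apply: measurableC; exact: compact_borel.
    - by apply: measurableC; exact: compact_borel.
    - exact: subsetC.
  have cK : compact (K0 `|` K1 `|` (K2 `|` K3)) by do 2?apply: compactU.
  move=> [|[|[|n]]].
  - by apply: sub pK0 => // x; left; left.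
  - by apply: sub pK1 => // x; left; right.
  - by apply: sub pK2 => // x; right; left.
  - by apply: sub pK3 => // x; right; right.
have mC i : measurable (C i : set BX).
  by apply: compact_borel => //; exact: (HC i).1.
pose S : set BX := \bigcup_i C i.
have mS : measurable S by exact: bigcup_measurable.
have mSc : measurable (~` S) by exact: measurableC.
have pS n : piece mu n (~` S) = 0.
  apply/eqP; rewrite -measure_le0; apply/lee_addgt0Pr => e e0; rewrite add0e.
  pose i := Num.truncn e^-1.
  apply: (@le_trans _ _ (i.+1%:R^-1)%:E).
    apply: le_trans ((HC i).2 n); apply: le_meas => //; first exact: measurableC.
    by apply: subsetC => x Cx; exists i.
  rewrite lee_fin -[leRHS]invrK lef_pV2 ?posrE ?invr_gt0// ltW//.
  exact: truncnS_gt.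
(* The complement of [S] is null for the restricted measure; joined to each [C i], it makes these
   sets cover the whole space. *)
have sf : sigma_finite setT (mrestr lam mS).
  exists (fun i => ~` S `|` C i).
    apply/seteqP; split => // x _; have [[i _ Cx]|nSx] := pselect (S x).
      by exists i => //; right.
    by exists 0%N => //; left.
  move=> i; split; first exact: measurableU.
  rewrite /= /mrestr setIUl setICl set0U; have [cfin _ _] := lamR.
  apply: le_lt_trans (cfin _ (HC i).1); apply: le_meas => //.
  exact: measurableI.
(* Inner regularity of the finite pieces extends the hypothesis from compact null sets to Borel
   sets. *)
have pnull n E : measurable E -> lam (E `&` S) = 0 -> piece mu n E = 0.
  move=> mE lE; have mES : measurable (E `&` S) by exact: measurableI.
  have -> : piece mu n E = piece mu n (E `\` S) + piece mu n (E `&` S).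
    exact: measureDI.
  have mED : measurable (E `\` S) by exact: measurableD.
  rewrite (subset_measure0 mED mSc _ (pS n)); last by move=> x [].
  rewrite add0e; apply/eqP; rewrite -measure_le0.
  apply/lee_addgt0Pr => e e0; rewrite add0e.
  have [K [cK KES pK]] := finite_radon_inner hX (pR n) mES e0.
  have mK := compact_borel hX cK.
  have mD : measurable ((E `&` S) `\` K) by exact: measurableD.
  have pK0 : piece mu n K = 0.
    by apply: null => //; exact: subset_measure0 mK mES KES lE.
  rewrite -(setDUK KES).
  apply: (@le_trans _ _ (piece mu n K + piece mu n ((E `&` S) `\` K))).
    exact: measureU2.
  by rewrite pK0 add0e.
have density (nu : {charge set BX -> \bar R}) :
    (forall E, measurable E -> lam (E `&` S) = 0 -> nu E = 0) ->
    exists2 f : X -> R, lam.-integrable [set: BX] (fun x => (f x)%:E) &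
      forall E, measurable E -> nu E = \int[lam]_(x in E) (f x)%:E.
  move=> nunull.
  pose lamS : {sigma_finite_measure set BX -> \bar R} := sigfm sf.
  have nulam : nu `<< lamS by apply/null_content_dominatesP => A mA; exact: nunull.
  pose g := Radon_Nikodym nu lamS.
  have [ig gE] : lam.-integrable [set: BX] (g \_ S) /\ forall E, measurable E ->
      \int[lamS]_(x in E) g x = \int[lam]_(x in E) (g \_ S) x.
    exact: (@integrable_mrestr lam S mS g (Radon_Nikodym_integrable nulam)).
  have fE : (fun x => (fine ((g \_ S) x))%:E) = g \_ S.
    apply/funext => x; rewrite fineK// /patch; case: ifPn => // _.
    exact: Radon_Nikodym_fin_num.
  exists (fun x => fine ((g \_ S) x)); first by rewrite fE.
  move=> E mE; rewrite (Radon_Nikodym_integral nulam mE) gE//.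
  by under [RHS]eq_integral do rewrite (congr1 (fun h => h _) fE).
have [|f1 if1 f1E] := density (cmre mu).
  move=> E mE lE; rewrite pos_neg_part//.
  by rewrite (pnull 0%N)// (pnull 2%N)// subee.
have [|f2 if2 f2E] := density (cmim mu).
  move=> E mE lE; rewrite pos_neg_part//.
  by rewrite (pnull 1%N)// (pnull 3%N)// subee.
have iC : integrableC lam (fun x => Complex (f1 x) (f2 x)) by split.
by exists (MkL1 iC) => E mE; split; [rewrite f1E|rewrite f2E].
Qed.

End Lambda_of_null.

(** * Topological groups and the space of cosets of a compact subgroup *)

Section group_topology.
Context {G : topologicalGroupType}.
Implicit Types x y : G.

Lemma mulgl_continuous x : continuous (fun y : G => (x * y)%g).
Proof.
move=> y; apply: (@continuous_comp _ _ _ (fun y : G => (x, y)) (fun p : G * G => (p.1 * p.2)%g)).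
  by apply: cvg_pair => /=; [exact: cvg_cst|exact: cvg_id].
exact: mulg_continuous.
Qed.

Lemma mulgr_continuous x : continuous (fun y : G => (y * x)%g).
Proof.
move=> y; apply: (@continuous_comp _ _ _ (fun y : G => (y, x)) (fun p : G * G => (p.1 * p.2)%g)).
  by apply: cvg_pair => /=; [exact: cvg_id|exact: cvg_cst].
exact: mulg_continuous.
Qed.

Lemma divgl_continuous : continuous (fun p : G * G => (p.1^-1 * p.2)%g).
Proof.
move=> p; apply: (@continuous_comp _ _ _ (fun p : G * G => (p.1^-1, p.2)%g)
  (fun p : G * G => (p.1 * p.2)%g)); last exact: mulg_continuous.
apply: cvg_pair => /=; last exact: cvg_snd.
by apply: (cvg_comp _ _ cvg_fst); exact: invg_continuous.
Qed.

Lemma compact_mulg (A B : set G) : compact A -> compact B ->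
  compact [set (p.1 * p.2)%g | p in A `*` B].
Proof.
move=> cA cB; apply: continuous_compact; last exact: compact_setX.
by apply: continuous_subspaceT; exact: mulg_continuous.
Qed.

End group_topology.

Section coset_topology.
Context {G : topologicalGroupType} (H : subgroup G).
Hypotheses (hG : hausdorff_space G) (lG : locally_compact [set: G]).
Hypothesis cH : compact (H : set G).
Local Notation X := (coset_space H).
Local Notation pi := (@coset_proj G H).

Lemma coset_proj_continuous : continuous pi.
Proof. exact: pi_continuous. Qed.

Lemma coset_reprK (q : X) : pi (coset_repr q) = q.
Proof. by rewrite /coset_proj /coset_repr reprK. Qed.

Lemma coset_projP x y : pi x = pi y <-> (H : set G) (x^-1 * y)%g.
Proof.
rewrite /coset_proj; split.
  by move=> /eqmodP/asboolP.
by move=> Hxy; apply/eqmodP/asboolP.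
Qed.

Lemma coset_proj_mul x h : (H : set G) h -> pi (x * h)%g = pi x.
Proof. by move=> Hh; apply/esym/coset_projP; rewrite mulKg. Qed.

Lemma open_coset_space (A : set X) : open (pi @^-1` A) -> open A.
Proof. by []. Qed.

(** The saturation of [U] is a union of right translates of [U] by elements of [H]. *)
Lemma open_coset_proj (U : set G) : open U -> open (pi @` U).
Proof.
move=> oU; apply: open_coset_space.
rewrite (_ : _ @^-1` _ = \bigcup_(h in (H : set G)) [set x | U (x * h)%g]).
  apply: bigcup_open => h _.
  by move: (@mulgr_continuous G h) => /continuousP; exact.
apply/seteqP; split => x /=.
  move=> [y Uy /esym/coset_projP Hxy]; exists (x^-1 * y)%g => //=.
  by rewrite mulVKg.
by move=> [h Hh /= Ux]; exists (x * h)%g => //; exact: coset_proj_mul.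
Qed.

(** Distinct cosets are disjoint compact sets, so they are separated by an open [V] and the
    complement of its closure. By the tube lemma the cosets of all points near [x], respectively
    [y], stay in these open sets, and the projections of the two neighbourhoods are disjoint. *)
Lemma coset_space_hausdorff : hausdorff_space X.
Proof.
rewrite open_hausdorff => p q pq.
set x := coset_repr p; set y := coset_repr q.
have fiber z : compact [set (z * h)%g | h in (H : set G)].
  apply: continuous_compact cH.
  by apply: continuous_subspaceT; exact: mulgl_continuous.
have oC : open (~` [set (y * h)%g | h in (H : set G)]).
  by apply: closed_openC; exact: compact_closed.
have xy : [set (x * h)%g | h in (H : set G)] `<=` ~` [set (y * h)%g | h in (H : set G)].
  move=> _ [h Hh <-] [k Hk kh]; move/eqP : pq; apply.
  rewrite -(coset_reprK p) -(coset_reprK q) -/x -/y.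
  by rewrite -(coset_proj_mul x Hh) -kh coset_proj_mul.
have [V [oV xV _ VC]] := compact_open_between hG lG (fiber x) oC xy.
have /nbhs_interior U1x : \forall x' \near x, forall h, (H : set G) h -> V (x' * h)%g.
  apply: (near_compact_image (a := x) (@mulg_continuous G) cH oV) => h Hh.
  by apply: xV; exists h.
have /nbhs_interior U2y : \forall y' \near y, forall h, (H : set G) h -> (~` closure V) (y' * h)%g.
  have oW : open (~` closure V) by apply: closed_openC; exact: closed_closure.
  apply: (near_compact_image (a := y) (@mulg_continuous G) cH oW) => h Hh.
  by move=> /VC; apply; exists h.
exists (pi @` [set x' | forall h, (H : set G) h -> V (x' * h)%g]°,
  pi @` [set y' | forall h, (H : set G) h -> (~` closure V) (y' * h)%g]°) => /=.
  split; apply/mem_set; [exists x|exists y] => //; last exact: coset_reprK.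
  - exact: nbhs_singleton.
  - exact: coset_reprK.
  - exact: nbhs_singleton.
split.
- by apply: open_coset_proj; exact: open_interior.
- by apply: open_coset_proj; exact: open_interior.
- apply/eqP; rewrite -subset0 => _ [[x' /interior_subset Vx' <-]].
  move=> [y' /interior_subset Vy' /coset_projP Hyx].
  have := Vy' _ Hyx; rewrite mulVKg; apply; apply: subset_closure.
  by have := Vx' _ (subgroup1 H); rewrite mulg1.
Qed.

Lemma coset_space_locally_compact : locally_compact [set: X].
Proof.
move=> q _; set x := coset_repr q.
have [V [cV clV Vx]] := compact_nbhs_ex lG x.
have cpV : compact (pi @` V).
  apply: continuous_compact cV.
  by apply: continuous_subspaceT; exact: coset_proj_continuous.
exists (pi @` V).
  rewrite /within /=.
  have : nbhs q (pi @` V°).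
    apply: open_nbhs_nbhs; split; first by apply: open_coset_proj; exact: open_interior.
    by exists x; [exact: nbhs_singleton (nbhs_interior Vx)|exact: coset_reprK].
  by apply: filterS => _ [z /interior_subset Vz <-] _; exists z.
by split => //; apply: compact_closed => //; exact: coset_space_hausdorff.
Qed.

(** A compact [D] in [G] projects onto a set containing [C]. The preimage is then a closed subset of
    the product of [D] and [H], which is compact because [H] is. *)
Lemma compact_coset_preimage (C : set X) : compact C -> compact (pi @^-1` C).
Proof.
move=> cC.
have [||q Cq|W [_ CW [D cD WD]]] := @compact_induction X C
    (fun W => exists2 D : set G, compact D & W `<=` pi @` D) cC.
- by exists set0; [exact: compact0|].
- move=> A B _ _ [D1 cD1 AD1] [D2 cD2 BD2]; exists (D1 `|` D2); first exact: compactU.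
  by rewrite image_setU; exact: setUSS.
- have [V [cV clV Vx]] := compact_nbhs_ex lG (coset_repr q).
  exists (pi @` V°); split.
  + by apply: open_coset_proj; exact: open_interior.
  + by exists (coset_repr q); [exact: nbhs_singleton (nbhs_interior Vx)|exact: coset_reprK].
  + by exists V => //; apply: image_subset; exact: interior_subset.
- apply: subclosed_compact (compact_mulg cD cH) _.
    apply: closed_comp; last exact: compact_closed coset_space_hausdorff cC.
    by move=> x _; exact: coset_proj_continuous.
  move=> x Cx; have [d Dd /coset_projP Hdx] := WD _ (CW _ Cx).
  by exists (d, d^-1 * x)%g => //=; rewrite mulVKg.
Qed.

End coset_topology.

(** * Translates and Haar measures of cosets as lower semicontinuous kernels *)

Section lsc_image.
Context {R : realType}.
Local Open Scope ereal_scope.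

(** Inner regularity yields a compact subset of the section with mass above [t], and the tube lemma
    keeps this compact set inside the sections at nearby parameters. *)
Lemma open_lt_measure_section (A : topologicalType) (Y Z : ptopologicalType)
    (m : {measure set (borel Y) -> \bar R}) (g : A * Y -> Z) (U : set Z) (t : R) :
  hausdorff_space Y -> finite_radon m -> continuous g -> open U ->
  open [set a | t%:E < m [set y | U (g (a, y))]].
Proof.
move=> hY mR cg oU.
have oS a : open [set y | U (g (a, y))].
  have ca : continuous (fun y => g (a, y)).
    move=> y; apply: (@continuous_comp _ _ _ (fun y => (a, y)) g); last exact: cg.
    by apply: cvg_pair => /=; [exact: cvg_cst|exact: cvg_id].
  by move/continuousP : ca; exact.
rewrite openE => a /= ta.
have [K [cK KU tK]] := finite_radon_lt hY mR (open_borel (oS a)) ta.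
have := near_compact_image cg cK oU KU.
apply: filterS => b Kb /=; apply: (lt_le_trans tK); apply: le_meas => //.
  exact: compact_borel.
exact: open_borel.
Qed.

End lsc_image.

Section kernels.
Context {R : realType} {G : topologicalGroupType} (H : subgroup G).
Hypotheses (hG : hausdorff_space G) (lG : locally_compact [set: G]).
Hypothesis cH : compact (H : set G).
Local Notation X := (coset_space H).
Local Notation pi := (@coset_proj G H).
Local Notation BG := (borel G).
Local Open Scope ereal_scope.

(** The convolution of the point mass at [x] with [m]; in [rtrans] the point mass stands on the
    right. *)
Definition ltrans (m : {measure set BG -> \bar R}) (x : G) :
    {measure set BG -> \bar R} :=
  image_measure m (continuous_borel (@mulgl_continuous G x)).

Definition rtrans (m : {measure set BG -> \bar R}) (x : G) :
    {measure set BG -> \bar R} :=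
  image_measure m (continuous_borel (@mulgr_continuous G x)).

Lemma ltrans_finite_radon m x : finite_radon m -> finite_radon (ltrans m x).
Proof. by apply: image_finite_radon => //; exact: mulgl_continuous. Qed.

Lemma rtrans_finite_radon m x : finite_radon m -> finite_radon (rtrans m x).
Proof. by apply: image_finite_radon => //; exact: mulgr_continuous. Qed.

Lemma ltransE m x E : ltrans m x E = m [set y | E (x * y)%g].
Proof. by []. Qed.

Lemma rtransE m x E : rtrans m x E = m [set y | E (y * x)%g].
Proof. by []. Qed.

Lemma rtrans_lsc m (U : set G) (t : R) : finite_radon m -> open U ->
  open [set x | t%:E < rtrans m x U].
Proof.
move=> mR oU.
have cs : continuous (fun p : G * G => (p.2 * p.1)%g).
  move=> p; apply: (@continuous_comp _ _ _ (fun p : G * G => (p.2, p.1))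
    (fun p : G * G => (p.1 * p.2)%g)); last exact: mulg_continuous.
  by apply: cvg_pair => /=; [exact: cvg_snd|exact: cvg_fst].
exact: (open_lt_measure_section t hG mR cs oU).
Qed.

Lemma measurable_rtrans m (E : set BG) : finite_radon m -> measurable E ->
  measurable_fun [set: BG] (fun x => rtrans m x E).
Proof.
move=> mR mE; apply: (@measurable_lsc_kernel R G G (rtrans m)) => //.
- by move=> x; exact: rtrans_finite_radon.
- by move=> U oU t; exact: rtrans_lsc.
Qed.

Variable mH : {measure set (borel (subgroup_type H)) -> \bar R}.
Hypotheses (haarH : left_haar mH) (normH : mH setT = 1).

Lemma subgroup_val_continuous : continuous (\val : subgroup_type H -> G).
Proof. exact: (@initial_continuous (subgroup_type H) G set_val). Qed.

Lemma subgroup_hausdorff : hausdorff_space (subgroup_type H).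
Proof.
move: (hG); rewrite !open_hausdorff => sep x y xy.
have [|[A B] /= [/set_mem Ax /set_mem By] [oA oB AB]] := sep (\val x) (\val y).
  by apply: contra_neq xy => /val_inj.
exists (\val @^-1` A, \val @^-1` B) => /=; first by split; apply/mem_set.
split.
- by move: subgroup_val_continuous => /continuousP; exact.
- by move: subgroup_val_continuous => /continuousP; exact.
- apply/eqP; rewrite -subset0 => z [Az Bz].
  by move/eqP : AB; rewrite -subset0; apply; split; [exact: Az|exact: Bz].
Qed.

Definition haarHG : {measure set BG -> \bar R} :=
  image_measure mH (continuous_borel subgroup_val_continuous).

Lemma haarHGE E : haarHG E = mH [set h | E (\val h)].
Proof. by []. Qed.

Lemma haarHG_finite_radon : finite_radon haarHG.
Proof.
apply: image_finite_radon => //.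
- exact: subgroup_hausdorff.
- exact: subgroup_val_continuous.
- by split; [rewrite normH ltry|case: haarH].
Qed.

Lemma haarHG_inv h (E : set BG) : (H : set G) h -> measurable E ->
  haarHG [set y | E (h * y)%g] = haarHG E.
Proof.
move=> Hh mE; pose hh : subgroup_type H := exist _ h (mem_set Hh).
have [_ _ inv] := haarH.
rewrite !haarHGE.
have mF : measurable ([set k | E (h * \val k)%g] : set (borel (subgroup_type H))).
  have mf := continuous_borel (@subgroup_val_continuous).
  have ml := continuous_borel (@mulgl_continuous G h).
  have := measurableT_comp ml mf.
  by move=> /(_ measurableT E mE); rewrite setTI.
rewrite -(inv hh _ mF); congr (mH _).
apply/seteqP; split => [_ [k /= Ek <-]//|k /= Ek].
exists (hh^-1 * k)%g; last by rewrite mulVKg.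
by rewrite /= mulVKg.
Qed.

(** The normalized Haar measure of [H] carried to the coset [q]. Integration against it is [P_H], so
    the lift of a positive measure is a mixture of these measures. *)
Definition lift_kernel (q : X) := ltrans haarHG (coset_repr q).

(** The chosen representative need not vary continuously with the coset. Left invariance of the Haar
    measure of [H] replaces it by an arbitrary [x], so that semicontinuity can be checked on [G] and
    passed to the quotient topology. *)
Lemma lift_kernel_proj x (E : set BG) : measurable E ->
  lift_kernel (pi x) E = haarHG [set y | E (x * y)%g].
Proof.
move=> mE; rewrite /lift_kernel ltransE.
set r := coset_repr (pi x).
have Hr : (H : set G) (x^-1 * r)%g by apply/coset_projP; rewrite coset_reprK.
have mEx : measurable ([set y | E (x * y)%g] : set BG).
  have mf := continuous_borel (@mulgl_continuous G x).
  by have := mf measurableT E mE; rewrite setTI.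
rewrite -(haarHG_inv Hr mEx); congr (haarHG _).
by apply/seteqP; split => y /=; rewrite !mulgA mulgV mul1g.
Qed.

Lemma lift_kernel_lsc (U : set G) (t : R) : open U ->
  open [set q | t%:E < lift_kernel q U].
Proof.
move=> oU; apply: open_coset_space.
rewrite (_ : _ @^-1` _ = [set x | t%:E < haarHG [set y | U (x * y)%g]]).
  exact: (open_lt_measure_section t hG haarHG_finite_radon mulg_continuous oU).
by apply/seteqP; split => x /=; rewrite lift_kernel_proj//; exact: open_borel.
Qed.

Lemma lift_kernel_finite_radon q : finite_radon (lift_kernel q).
Proof. exact/ltrans_finite_radon/haarHG_finite_radon. Qed.

Lemma lift_kernelT q : lift_kernel q setT <= 1%:E.
Proof. by rewrite ltransE haarHGE normH. Qed.

Lemma measurable_lift_kernel (E : set BG) : measurable E ->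
  measurable_fun [set: borel X] (fun q => lift_kernel q E).
Proof.
apply: (@measurable_lsc_kernel R X G lift_kernel).
- exact: lift_kernel_finite_radon.
- by move=> U oU t; exact: lift_kernel_lsc.
Qed.

Lemma P_HE (f : G -> R[i]) q : bounded_borelC f ->
  P_H mH f q = integralC (lift_kernel q) f.
Proof.
move=> bf; have HT : mH setT < +oo by rewrite normH ltry.
rewrite integralC_image//.
rewrite integralC_image//.
by apply: bounded_borelC_comp => //; apply: continuous_borel; exact: mulgl_continuous.
Qed.

End kernels.

(** * Existence of the lift, the convolution and the push-forward *)

Section mixture_complex.
Context {R : realType} {X Z : ptopologicalType}.
Hypotheses (hX : hausdorff_space X) (hZ : hausdorff_space Z).
Hypothesis lZ : locally_compact [set: Z].

Lemma mixture_exC (sigma : {measure set (borel X) -> \bar R})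
    (k : X -> {measure set (borel Z) -> \bar R}) (C : R) :
  finite_radon sigma -> (forall q, finite_radon (k q)) ->
  (forall q, k q setT <= C%:E)%E ->
  (forall U : set Z, open U -> forall t : R, open [set q | (t%:E < k q U)%E]) ->
  exists m : {measure set (borel Z) -> \bar R}, [/\ finite_radon m,
    forall E, measurable E -> m E = (\int[sigma]_q k q E)%E &
    forall f, bounded_borelC f ->
      bounded_borelC (fun q => integralC (k q) f) /\
      integralC m f = integralC sigma (fun q => integralC (k q) f)].
Proof.
move=> sR kR kC klsc.
have [m [mR mE mI]] := mixture_ex hX hZ lZ sR kR kC klsc.
exists m; split => // f [f1 f2].
have mk E (mE' : measurable E) := measurable_lsc_kernel kR klsc mE'.
have [b1 e1] := mixture_Rintegral sR.1 mR.1 kC mk mI f1.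
have [b2 e2] := mixture_Rintegral sR.1 mR.1 kC mk mI f2.
by split => //; apply: complex_ext.
Qed.

End mixture_complex.

(** The difference [k - i] modulo 4; the added 4 keeps the truncated subtraction exact for [i] at
    most 4. *)
Definition cyc4 (k i : nat) := ((k + 4 - i) %% 4)%N.

(** The term of indices [i] and [j] carries the factor [z ^+ (i + j)], which depends only on [i + j]
    modulo 4; the left side collects the terms by this residue. *)
Lemma sum_expr_cyc4 (C : comNzRingType) (z : C) (A : nat -> nat -> C) :
  z ^+ 4 = 1 ->
  \sum_(k < 4) z ^+ k * \sum_(i < 4) A i (cyc4 k i) =
  \sum_(j < 4) z ^+ j * \sum_(i < 4) z ^+ i * A i j.
Proof.
move=> z4.
have z5 : z ^+ 5 = z by rewrite exprS z4 mulr1.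
have z6 : z ^+ 6 = z ^+ 2 by rewrite exprS z5.
rewrite [LHS](eq_bigr (fun k : 'I_4 => \sum_(i < 4) z ^+ k * A i (cyc4 k i)));
  last by move=> k _; rewrite mulr_sumr.
rewrite [RHS](eq_bigr (fun j : 'I_4 => \sum_(i < 4) z ^+ (j + i) * A i j));
  last by move=> j _; rewrite mulr_sumr; apply: eq_bigr => i _; rewrite mulrA exprD.
rewrite exchange_big [RHS]exchange_big /=; apply: eq_bigr => i _.
rewrite !big_ord_recl !big_ord0.
by case: i => [[|[|[|[|//]]]] Hi] /=; rewrite /cyc4 /= /bump /=;
  repeat match goal with
  | |- context [A _ ?n] =>
    let n' := eval vm_compute in n in progress change n with n'
  | |- context [z ^+ ?n] =>
    let n' := eval vm_compute in n in progress change n with n'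
  end; rewrite ?z4 ?z5 ?z6; ring.
Qed.

Section existence.
Context {R : realType} {G : topologicalGroupType} (H : subgroup G).
Hypotheses (hG : hausdorff_space G) (lG : locally_compact [set: G]).
Hypothesis cH : compact (H : set G).
Local Notation X := (coset_space H).
Local Notation pi := (@coset_proj G H).
Local Notation BG := (borel G).
Variable mH : {measure set (borel (subgroup_type H)) -> \bar R}.
Hypotheses (haarH : left_haar mH) (normH : mH setT = 1%E).

Let hX : hausdorff_space X := coset_space_hausdorff hG lG cH.

Let conv_kernelE (t : {measure set BG -> \bar R}) y f :
  (t setT < +oo)%E -> bounded_borelC f ->
  integralC (rtrans t y) f = integralC t (fun x => f (x * y)%g).
Proof. by move=> tT bf; rewrite integralC_image. Qed.

Lemma lift_PH_ex (sigma : cmeasure R X) : M R X sigma ->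
  exists tau : cmeasure R G, lift_PH mH sigma tau /\
    forall n E, measurable E ->
      (piece tau n E <= \int[piece sigma n]_q lift_kernel mH q E)%E.
Proof.
move=> Ms; have sR n := piece_finite_radon n Ms.
have /choice[m mP] n := mixture_exC hX hG lG (sR n)
  (lift_kernel_finite_radon hG haarH normH) (lift_kernelT normH)
  (fun U oU t => lift_kernel_lsc hG haarH normH t oU).
have mR n : finite_radon (m n) by have [] := mP n.
have [tau [Mt tle tI]] := cmeasure_of_pieces hG mR.
exists tau; split.
  split => // f /Cc_bounded_borelC bf; rewrite tI// cmintE.
  apply: eq_bigr => n _; congr (_ * _).
  have [_ _ /(_ f bf)[_ ->]] := mP n.
  by apply: eq_integralC => q; rewrite P_HE.
move=> n E mE; rewrite (piece_minn tau) (piece_minn sigma).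
have n4 : (minn n 3 < 4)%N by rewrite ltnS geq_minr.
by apply: (le_trans (tle _ _ n4 mE)); have [_ -> //] := mP (minn n 3).
Qed.

(** Each of the sixteen pairs of pieces gives a positive mixture; those with [i + j] congruent to
    [k] modulo 4 share the coefficient ['i ^+ k] and are added up. The second conclusion asks for
    nullity over all pairs, so its users need not know the grouping. *)
Lemma conv_group_ex (tau1 tau2 : cmeasure R G) : M R G tau1 -> M R G tau2 ->
  exists mu : cmeasure R G, conv_group tau1 tau2 mu /\
    forall n E, measurable E ->
      (forall i j, \int[piece tau2 j]_y rtrans (piece tau1 i) y E = 0)%E ->
      piece mu n E = 0%E.
Proof.
move=> M1 M2.
have t1R n := piece_finite_radon n M1; have t2R n := piece_finite_radon n M2.
have t1T n : (piece tau1 n setT <= (fine (piece tau1 n setT))%:E)%E.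
  by rewrite fineK// ge0_fin_numE//; exact: piece_fin.
have /choice[m mP] (ij : nat * nat) := mixture_exC hG hG lG (t2R ij.2)
  (fun y => rtrans_finite_radon hG y (t1R ij.1)) (fun y => t1T ij.1)
  (fun U oU t => rtrans_lsc hG t (t1R ij.1) oU).
have mR ij : finite_radon (m ij) by have [] := mP ij.
have nR k : finite_radon (msum (fun i => m (i, cyc4 k i)) 4).
  by apply: msum_finite_radon.
have [mu [Mmu mule muI]] := cmeasure_of_pieces hG nR.
exists mu; split.
  split => // f /Cc_bounded_borelC bf; rewrite muI//.
  under eq_bigr => k _.
    rewrite integralC_msum//; last by move=> i; exact: (mR _).1.
    over.
  pose A i j := integralC (m (i, j)) f.
  transitivity (\sum_(j < 4) 'i ^+ j * \sum_(i < 4) 'i ^+ i * A i j); last first.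
    rewrite cmintE; apply: eq_bigr => j _; congr (_ * _).
    transitivity (\sum_(i < 4) 'i ^+ i * integralC (piece tau2 j)
        (fun y => integralC (rtrans (piece tau1 i) y) f)).
      apply: eq_bigr => i _; congr (_ * _).
      by have [_ _ /(_ f bf)[_ AE]] := mP (val i, val j); rewrite /A AE.
    rewrite -integralC_sum; last 2 first.
    - exact: piece_fin.
    - by move=> i; have [_ _ /(_ f bf)[]] := mP (val i, val j).
    apply: eq_integralC => y; rewrite cmintE; apply: eq_bigr => i _.
    by rewrite conv_kernelE//; exact: piece_fin.
  apply: (sum_expr_cyc4 A).
  by rewrite (exprM _ 2 2) sqr_i sqrrN expr1n.
move=> n E mE null; rewrite piece_minn.
have p4 : (minn n 3 < 4)%N by rewrite ltnS geq_minr.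
apply/eqP; rewrite -measure_le0; apply: le_trans (mule _ _ p4 mE) _.
rewrite /= /msum big1// => i _.
by have [_ -> //] := mP (val i, cyc4 (minn n 3) i).
Qed.

Lemma push_RH_ex (mu : cmeasure R G) : M R G mu ->
  exists kappa : cmeasure R X, push_RH mu kappa /\
    forall n E, measurable E -> (piece kappa n E <= piece mu n (pi @^-1` E))%E.
Proof.
move=> Mmu; have mR n := piece_finite_radon n Mmu.
have mpi := continuous_borel (@coset_proj_continuous G H).
have iR n : finite_radon (image_measure (piece mu n) mpi).
  by apply: image_finite_radon => //; exact: coset_proj_continuous.
have [kappa [Mk kle kI]] := cmeasure_of_pieces hX iR.
exists kappa; split.
  split => // f /Cc_bounded_borelC bf; rewrite kI// cmintE.
  apply: eq_bigr => n _; congr (_ * _); rewrite integralC_image//.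
  exact: piece_fin.
move=> n E mE; rewrite (piece_minn kappa) (piece_minn mu).
by apply: kle => //; rewrite ltnS geq_minr.
Qed.

End existence.

(** * Null sets of a convolution *)

Section null_convolution.
Local Open Scope ereal_scope.
Context {R : realType} {G : topologicalGroupType}.
Hypotheses (hG : hausdorff_space G).
Local Notation BG := (borel G).

(* Tonelli's theorem for the compact set [(x, y) | x * y \in L] would do, but
   it need not belong to the product sigma-algebra. *)
Lemma null_convolution (t1 t2 : {measure set BG -> \bar R}) (L : set G) :
  finite_radon t1 -> finite_radon t2 -> compact L ->
  (forall x, t2 [set y | L (x * y)%g] = 0) ->
  \int[t2]_y rtrans t1 y L = 0.
Proof.
move=> t1R t2R cL null.
have mL := compact_borel hG cL.
have t1f (A : set BG) : measurable A -> t1 A \is a fin_num.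
  by move=> mA; rewrite ge0_fin_numE// (le_lt_trans _ t1R.1)//; exact: le_meas.
have t2f (A : set BG) : measurable A -> t2 A \is a fin_num.
  by move=> mA; rewrite ge0_fin_numE// (le_lt_trans _ t2R.1)//; exact: le_meas.
have mLy y : measurable ([set x | L (x * y)%g] : set BG).
  have mf := continuous_borel (@mulgr_continuous G y).
  by have := mf measurableT L mL; rewrite setTI.
have mLx x : measurable ([set y | L (x * y)%g] : set BG).
  have mf := continuous_borel (@mulgl_continuous G x).
  by have := mf measurableT L mL; rewrite setTI.
have mrR (A : set BG) (mA : measurable A) : finite_radon (mrestr t1 mA).
  apply: (le_finite_radon hG t1R) => E mE; rewrite /= /mrestr; apply: le_meas => //.
  exact: measurableI.
pose F (A : set BG) (y : BG) := t1 ([set x | L (x * y)%g] `&` A).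
have mF (A : set BG) : measurable A -> measurable_fun [set: BG] (F A).
  by move=> mA; exact: (measurable_rtrans hG (mrR A mA) mL).
(* Localisation in [x]: for [x] near [x0], the [y] with [x * y] in [L] all avoid one compact [K]
   whose complement has [t2]-measure at most [e]. For [A] in this neighbourhood, [F A] vanishes on
   [K] and is at most [t1 A] elsewhere. *)
have small (e : R) : (0 < e)%R -> forall x0 : G, exists W, [/\ open W, W x0 &
    forall A : set BG, measurable A -> A `<=` W ->
      \int[t2]_y F A y <= e%:E * t1 A].
  move=> e0 x0.
  have mN : measurable (~` [set y | L (x0 * y)%g] : set BG) by exact: measurableC.
  have [K [cK KN tK]] := finite_radon_inner hG t2R mN e0.
  have mK := compact_borel hG cK.
  have oV : open (~` K) by apply: closed_openC; exact: compact_closed.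
  have tV : t2 (~` K) <= e%:E.
    apply: (@le_trans _ _ (t2 ([set y | L (x0 * y)%g] `|`
        (~` [set y | L (x0 * y)%g] `\` K)))).
      apply: le_meas; first exact: measurableC.
        by apply: measurableU => //; exact: measurableD.
      move=> y Ky; have [Ly|Ly] := pselect (L (x0 * y)%g); first by left.
      by right.
    apply: (@le_trans _ _ (t2 [set y | L (x0 * y)%g] +
        t2 (~` [set y | L (x0 * y)%g] `\` K))).
      by apply: measureU2 => //; exact: measurableD.
    by rewrite null add0e.
  have /nbhs_interior Wx0 : \forall x \near x0, forall z, L z -> (~` K) (x^-1 * z)%g.
    apply: (near_compact_image (a := x0) (@divgl_continuous G) cL oV) => z Lz /=.
    by move=> /KN; apply; rewrite /= mulVKg.
  exists [set x | forall z, L z -> (~` K) (x^-1 * z)%g]°; split.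
  - exact: open_interior.
  - exact: nbhs_singleton.
  - move=> A mA AW.
    have mI : measurable_fun [set: BG] (fun y : BG => (\1_(~` K) y : R)%:E).
      by apply/measurable_EFinP; apply: measurable_indic; exact: measurableC.
    apply: (@le_trans _ _ (\int[t2]_y (t1 A * (\1_(~` K) y)%:E))).
      apply: ge0_le_integral => //; first exact: mF.
        by apply: emeasurable_funM.
      move=> y _; have [Ky|Ky] := pselect (K y).
        rewrite indicE memNset; last exact.
        rewrite mule0 /F (_ : _ `&` _ = set0) ?measure0//.
        rewrite -subset0 => x [/= Lxy /AW/interior_subset/(_ _ Lxy)].
        by rewrite mulKg; apply.
      rewrite indicE mem_set// mule1; apply: le_meas => //; first exact: measurableI.
    have mKc : measurable (~` K : set BG) by exact: measurableC.
    rewrite ge0_integralZl//.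
    by rewrite integral_indic// setIT muleC lee_wpmul2r.
apply/eqP; rewrite eq_le integral_ge0 ?andbT; last by move=> y _.
apply/lee_addgt0Pr => e e0; rewrite add0e.
pose T1 := fine (t1 setT); pose T2 := fine (t2 setT).
have T10 : (0 <= T1)%R by exact: fine_ge0.
have T20 : (0 <= T2)%R by exact: fine_ge0.
(* [d1] is the factor allowed in the bound over a compact [K], and [d2] the [t1]-mass allowed
   outside [K]. Multiplied by the total masses of [t1] and [t2] respectively, each contributes at
   most [e / 2]. *)
pose d1 := (e / (2 * (T1 + 1)))%R; pose d2 := (e / (2 * (T2 + 1)))%R.
have d10 : (0 < d1)%R by rewrite divr_gt0// mulr_gt0// ltr_wpDl.
have d20 : (0 < d2)%R by rewrite divr_gt0// mulr_gt0// ltr_wpDl.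
have [K [cK _ tK]] := finite_radon_inner hG t1R measurableT d20.
have mK := compact_borel hG cK.
(* The bound is required for all Borel subsets of [W] because both of its sides are additive in [A]:
   over a union, [A] is cut along [W1]. *)
have [||x Kx|W [oW KW WP]] := @compact_induction G K
  (fun W => forall A : set BG, measurable A -> A `<=` W ->
    \int[t2]_y F A y <= d1%:E * t1 A) cK.
- move=> A mA; rewrite subset0 => ->; rewrite measure0 mule0.
  by rewrite integral0_eq// => y _; rewrite /F setI0 measure0.
- move=> W1 W2 oW1 oW2 P1 P2 A mA AW.
  have mW1 := open_borel oW1.
  have mA1 : measurable (A `&` W1 : set BG) by exact: measurableI.
  have mA2 : measurable (A `\` W1 : set BG) by exact: measurableD.
  rewrite (_ : \int[t2]_y F A y = \int[t2]_y (F (A `\` W1) y + F (A `&` W1) y)); last first.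
    apply: eq_integral => y _; rewrite /F.
    rewrite (_ : t1 _ = t1 (([set x | L (x * y)%g] `&` A) `\` W1) +
        t1 (([set x | L (x * y)%g] `&` A) `&` W1)); last first.
      by apply: measureDI => //; exact: measurableI.
    by rewrite setIDA -setIA.
  rewrite ge0_integralD//; [|exact: mF..].
  rewrite (_ : t1 A = t1 (A `\` W1) + t1 (A `&` W1)); last exact: measureDI.
  rewrite ge0_muleDr//; apply: leeD.
    by apply: P2 => // x [/AW[]].
  by apply: P1 => // x [].
- exact: small.
- have mKc : measurable (~` K : set BG) by exact: measurableC.
  apply: (@le_trans _ _ (\int[t2]_y (F K y + t1 (~` K)))).
    apply: ge0_le_integral => //.
    + exact: (measurable_rtrans hG t1R mL).
    + by apply: emeasurable_funD => //; exact: mF.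
    + move=> y _; rewrite rtransE.
      apply: (@le_trans _ _ (t1 (([set x | L (x * y)%g] `&` K) `|` ~` K))).
        apply: le_meas => //; first by apply: measurableU => //; exact: measurableI.
        by move=> x Lx; have [Kx|Kx] := pselect (K x); [left|right].
      by apply: measureU2 => //; exact: measurableI.
  rewrite ge0_integralD//; last exact: mF.
  rewrite integral_cst//.
  apply: (@le_trans _ _ (d1%:E * T1%:E + d2%:E * T2%:E)).
    apply: leeD.
      apply: (le_trans (WP _ mK KW)); apply: lee_wpmul2l.
        by rewrite lee_fin ltW.
      by rewrite /T1 fineK ?t1f//; exact: le_meas.
    rewrite /T2 fineK ?t2f// lee_wpmul2r//.
    by move: tK; rewrite setTD.
  rewrite -!EFinM -EFinD lee_fin.
  have half (T : R) : (0 <= T)%R -> (e / (2 * (T + 1)) * T <= e / 2)%R.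
    move=> T0; rewrite (_ : (e / (2 * (T + 1)) * T = e / 2 * (T / (T + 1)))%R); last first.
      by field; rewrite gt_eqF// ltr_wpDl.
    rewrite ler_piMr// ?divr_ge0// ?ltW//.
    by rewrite ltr_pdivrMr ?mul1r ?ltrDl// ltr_wpDl.
  by have := half _ T10; have := half _ T20; rewrite /d1 /d2; lra.
Qed.

End null_convolution.

(** * Weil's formula and null sets *)

Section compact_support.
Local Open Scope ereal_scope.
Context {R : realType} {X : ptopologicalType}.
Hypothesis hX : hausdorff_space X.
Local Notation BX := (borel X).

Lemma continuous_compact_ubound (f : X -> R) (K : set X) :
  continuous f -> compact K -> exists2 c, (0 < c)%R & forall x, K x -> (f x <= c)%R.
Proof.
move=> cf cK.
have cfK : compact (f @` K).
  by apply: continuous_compact => //; exact: continuous_subspaceT.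
have [M [_ fM]] := compact_bounded cfK.
exists (`|M| + 1)%R; first by rewrite ltr_wpDl.
move=> x Kx; apply: le_trans (ler_norm _) _.
by apply: (fM (`|M| + 1)%R); [rewrite (le_lt_trans (ler_norm M))// ltrDl|exists x].
Qed.

Lemma compact_support_integral_lty (m : {measure set BX -> \bar R}) (S : set X)
    (D : R) (F : BX -> \bar R) :
  compact S -> m S < +oo -> measurable_fun [set: BX] F ->
  (forall x, 0 <= F x) -> (forall x, F x <= D%:E) -> (forall x, ~ S x -> F x = 0) ->
  \int[m]_x F x < +oo.
Proof.
move=> cS mS mF F0 FD FS; have mbS := compact_borel hX cS.
have D0 : 0 <= D%:E by exact: le_trans (FD point).
apply: (@le_lt_trans _ _ (\int[m]_x (D%:E * (\1_S x)%:E))).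
  apply: ge0_le_integral => //.
    by apply: emeasurable_funM => //; apply/measurable_EFinP; exact: measurable_indic.
  move=> x _; have [Sx|Sx] := pselect (S x).
    by rewrite indicE mem_set// mule1.
  by rewrite indicE memNset// mule0 FS.
rewrite ge0_integralZl//; last first.
  by apply/measurable_EFinP; exact: measurable_indic.
by rewrite integral_indic// setIT lte_mul_pinfty.
Qed.

End compact_support.

Section weil.
Local Open Scope ereal_scope.
Context {R : realType} {G : topologicalGroupType} (H : subgroup G).
Hypotheses (hG : hausdorff_space G) (lG : locally_compact [set: G]).
Hypothesis cH : compact (H : set G).
Local Notation X := (coset_space H).
Local Notation pi := (@coset_proj G H).
Local Notation BG := (borel G).
Local Notation BX := (borel X).
Variables (mG : {measure set BG -> \bar R})
  (mH : {measure set (borel (subgroup_type H)) -> \bar R})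
  (lam : {measure set BX -> \bar R}) (rho : G -> R).
Hypotheses (mGR : radon mG) (haarH : left_haar mH) (normH : mH setT = 1).
Hypotheses (crho : continuous rho) (rho0 : forall x, (0 < rho x)%R).
Hypotheses (lamR : radon lam) (lam_rho : arises_from mG mH rho lam).

Let hX : hausdorff_space X := coset_space_hausdorff hG lG cH.
Let lX : locally_compact [set: X] := coset_space_locally_compact hG lG cH.

Lemma lift_kernel_integral q (f : BG -> \bar R) :
  measurable_fun [set: BG] f -> (forall x, 0 <= f x) ->
  \int[lift_kernel mH q]_x f x = \int[mH]_h f (coset_repr q * \val h)%g.
Proof.
move=> mf f0.
have mx := continuous_borel (@mulgl_continuous G (coset_repr q)).
have mv := continuous_borel (@subgroup_val_continuous G H).
rewrite [LHS](ge0_integral_pushforward mx)//.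
rewrite preimage_setT [LHS](ge0_integral_pushforward mv)//.
  exact: measurableT_comp mf mx.
by move=> x _; exact: f0.
Qed.

Lemma measurable_lift_kernel_integral (f : BG -> \bar R) :
  measurable_fun [set: BG] f -> (forall x, 0 <= f x) ->
  measurable_fun [set: BX] (fun q => \int[lift_kernel mH q]_x f x).
Proof.
move=> mf f0.
apply: (@measurable_fun_integral_kernel _ _ BX BG R (lift_kernel mH)) => // U.
exact: measurable_lift_kernel.
Qed.

(** [arises_from] equates integrals read through [fine], which sends an infinite value to 0. The
    identity holds in the extended reals once both sides are known to be finite: each integrand is
    bounded and vanishes off a compact set. *)
Lemma weil_ge0 (f : G -> R) : continuous f -> (forall x, 0 <= f x)%R ->
  compact (closure [set x | f x != 0%R]) ->
  \int[mG]_x (f x)%:E = \int[lam]_q \int[lift_kernel mH q]_x (f x / rho x)%:E.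
Proof.
move=> cf f0 cS; set S := closure _ in cS.
pose g x := (f x / rho x)%R.
have g0 x : (0 <= g x)%R by rewrite divr_ge0// ltW.
have cg : continuous g.
  move=> x; apply: cvgM; first exact: cf.
  by apply: cvgV; [rewrite gt_eqF|exact: crho].
have cSg : compact (closure [set x | g x != 0%R]).
  apply: subclosed_compact cS _; first exact: closed_closure.
  by apply: closureS => x /=; apply: contra_neq => fx; rewrite /g fx mul0r.
have fS x : ~ S x -> f x = 0%R.
  by move=> Sx; apply: contrapT => /eqP fx; apply: Sx; exact: subset_closure.
have bf := compact_support_bounded_borel cf cS.
have bg := compact_support_bounded_borel cg cSg.
have mgE : measurable_fun [set: BG] (fun x : BG => (g x)%:E).
  by apply/measurable_EFinP; exact: bg.1.
have gE0 x : 0 <= (g x)%:E by rewrite lee_fin.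
have gkE q : (\int[lift_kernel mH q]_x g x)%:E = \int[lift_kernel mH q]_x (g x)%:E.
  apply: bounded_borel_ge0_integral => //.
  by apply: le_lt_trans (lift_kernelT normH q) _; rewrite ltry.
have intG : \int[mG]_x (f x)%:E < +oo.
  have [D fD] := bf.2.
  apply: (compact_support_integral_lty hG cS (D := D)).
  - by case: mGR => + _ _; exact.
  - by apply/measurable_EFinP; exact: bf.1.
  - by move=> x; rewrite lee_fin.
  - by move=> x; rewrite lee_fin (le_trans (ler_norm _)).
  - by move=> x /fS ->.
have intX : \int[lam]_q \int[lift_kernel mH q]_x (g x)%:E < +oo.
  have cpS : compact (pi @` S).
    apply: continuous_compact cS.
    by apply: continuous_subspaceT; exact: coset_proj_continuous.
  have [D gD] := bg.2.
  have D0 : (0 <= D)%R by apply: le_trans (gD point).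
  apply: (compact_support_integral_lty hX cpS (D := D)).
  - by case: lamR => + _ _; exact.
  - exact: measurable_lift_kernel_integral.
  - by move=> q; exact: integral_ge0.
  - move=> q; rewrite lift_kernel_integral//.
    rewrite -[leRHS]mule1 -normH -integral_cst//.
    apply: ge0_le_integral => //.
    + have mv := continuous_borel (@subgroup_val_continuous G H).
      apply: (measurableT_comp mgE).
      apply: measurableT_comp mv.
      by apply: continuous_borel; exact: mulgl_continuous.
    + by move=> h _; rewrite lee_fin (le_trans (ler_norm _)).
  - move=> q Sq; rewrite lift_kernel_integral// integral0_eq// => h _.
    rewrite /g fS ?mul0r// => Sqh; apply: Sq; exists (coset_repr q * \val h)%g => //.
    by rewrite coset_proj_mul ?coset_reprK//; exact: set_mem (valP h).
have fCE : (fun x => (f x)%:C%C / (rho x)%:C%C)%R = (fun x => (g x)%:C%C).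
  by apply/funext => x; rewrite /g rmorphM fmorphV.
have : (\int[mG]_x f x = \int[lam]_q \int[lift_kernel mH q]_x g x)%R.
  rewrite -[LHS]/(complex.Re (integralC mG (fun x => (f x)%:C%C))).
  rewrite (lam_rho (real_Cc cf cS)) fCE; apply: eq_Rintegral => q _.
  by rewrite P_HE//; exact: Cc_bounded_borelC (real_Cc cg cSg).
rewrite /Rintegral => /(congr1 (@EFin R)).
rewrite fineK; last by rewrite ge0_fin_numE// integral_ge0// => x _; rewrite lee_fin.
under [in X in _ = X -> _]eq_integral => q _ do rewrite gkE.
rewrite fineK// ge0_fin_numE//; apply: integral_ge0 => q _; exact: integral_ge0.
Qed.

(** Weil's formula is applied to [f = (g o pi) * rho], with [g] a Urysohn function of [C]: the mean
    of [f / rho] over a coset [q] is just [g q]. As [D] bounds [1 / rho] on [L], the indicator of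
    [L] is at most [D * f], so [mG L] is at most [D * lam V]. *)
Lemma null_preimage (C : set X) : compact C -> lam C = 0 -> mG (pi @^-1` C) = 0.
Proof.
move=> cC C0; set L := pi @^-1` C.
have cL : compact L by exact: compact_coset_preimage.
have mL := compact_borel hG cL.
have cirho : continuous (fun x => (rho x)^-1)%R.
  by move=> x; apply: cvgV; [rewrite gt_eqF|exact: crho].
have [D D0 rhoD] := continuous_compact_ubound cirho cL.
apply/eqP; rewrite eq_le measure_ge0 andbT.
apply/lee_addgt0Pr => e e0; rewrite add0e.
have [V [oV CV lamV]] : exists V : set X, [/\ open V, C `<=` V & lam V < (e / D)%:E].
  have [_ out _] := lamR.
  have : ereal_inf [set lam U | U in [set U : set X | open U /\ C `<=` U]] < (e / D)%:E.
    by rewrite -out ?C0 ?lte_fin ?divr_gt0//; exact: compact_borel.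
  by move=> /ereal_inf_lt[_ [V [oV CV] <-] lamV]; exists V.
have [g [cg g01 gC gV cSg]] := urysohn_compact hX lX R cC oV CV.
have mV := open_borel oV.
have g0 q : (0 <= g q)%R by have /andP[] := g01 q.
have g1 q : (g q <= 1)%R by have /andP[] := g01 q.
pose f x := (g (pi x) * rho x)%R.
have cf : continuous f.
  move=> x; apply: cvgM; last exact: crho.
  by apply: (@continuous_comp _ _ _ pi g); [exact: coset_proj_continuous|exact: cg].
have f0 x : (0 <= f x)%R by rewrite mulr_ge0// ltW.
have cSf : compact (closure [set x | f x != 0%R]).
  apply: subclosed_compact (compact_coset_preimage hG lG cH cSg) _.
    exact: closed_closure.
  have clS : closed (pi @^-1` closure [set q | g q != 0%R]).
    move: (@coset_proj_continuous G H) => /continuous_closedP; apply.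
    exact: closed_closure.
  rewrite [X in _ `<=` X](closure_id _).1//; apply: closureS => x /= fx.
  by apply: subset_closure => /=; apply: contra_neq fx; rewrite /f => ->; rewrite mul0r.
have mf : measurable_fun [set: BG] (fun x : BG => (f x)%:E).
  by apply/measurable_EFinP; exact: continuous_borel_real.
rewrite -[L]setIT -(@integral_indic _ _ _ mG setT)//.
apply: (@le_trans _ _ (\int[mG]_x (D%:E * (f x)%:E))).
  apply: ge0_le_integral => //.
  - by apply/measurable_EFinP; exact: measurable_indic.
  - exact: emeasurable_funM.
  - move=> x _; rewrite lee_fin; have [Lx|Lx] := pselect (L x).
      rewrite indicE mem_set// /f gC// mul1r -(@mulVf _ (rho x)) ?gt_eqF//.
      by rewrite ler_wpM2r ?rhoD// ltW.
    by rewrite indicE memNset// mulr_ge0// ltW.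
rewrite ge0_integralZl//; [|by move=> x _; rewrite lee_fin|by rewrite lee_fin ltW].
rewrite weil_ge0//.
have gE q : \int[lift_kernel mH q]_x (f x / rho x)%:E = (g q)%:E.
  rewrite lift_kernel_integral; first last.
  - by move=> x; rewrite lee_fin divr_ge0// ltW.
  - apply/measurable_EFinP; apply: continuous_borel_real => x.
    by apply: cvgM; [exact: cf|exact: cirho].
  rewrite (eq_integral (fun=> (g q)%:E)).
    by rewrite integral_cst// normH mule1.
  move=> h _; rewrite /f mulfK ?gt_eqF// coset_proj_mul ?coset_reprK//.
  exact: set_mem (valP h).
under eq_integral => q _ do rewrite gE.
apply: (@le_trans _ _ (D%:E * lam V)); last first.
  rewrite (_ : e%:E = D%:E * (e / D)%:E); first by apply: lee_wpmul2l; rewrite ?lee_fin ltW.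
  by rewrite -EFinM mulrC divfK// gt_eqF.
apply: lee_wpmul2l; first by rewrite lee_fin ltW.
rewrite -[V]setIT -(@integral_indic _ _ _ lam setT)//.
apply: ge0_le_integral => //.
- by move=> q _; rewrite lee_fin.
- by apply/measurable_EFinP; exact: continuous_borel_real.
- by apply/measurable_EFinP; exact: measurable_indic.
- move=> q _; rewrite lee_fin; have [Vq|Vq] := pselect (V q).
    by rewrite indicE mem_set.
  by rewrite gV.
Qed.

(** The case of [lam] comes first: for a Urysohn function [f] of [K] and a bound [D] of [rho] on
    [K], the indicator of [K] is at most [D * f / rho], whose double integral is [D] times the
    [mG]-integral of [f] by Weil's formula. *)
Lemma null_lift (p : {measure set BX -> \bar R}) (K : set G) :
  compact K -> mG K = 0 ->
  (forall E, measurable E -> lam E = 0 -> p E = 0) ->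
  \int[p]_q lift_kernel mH q K = 0.
Proof.
move=> cK K0 pnull.
have mK := compact_borel hG cK.
have mkK := measurable_lift_kernel hG haarH normH mK.
have [D D0 rhoD] := continuous_compact_ubound crho cK.
have lamK : \int[lam]_q lift_kernel mH q K = 0.
  apply/eqP; rewrite eq_le integral_ge0 ?andbT//.
  apply/lee_addgt0Pr => e e0; rewrite add0e.
  have [V [oV KV mGV]] : exists V : set G, [/\ open V, K `<=` V & mG V < (e / D)%:E].
    have [_ out _] := mGR.
    have : ereal_inf [set mG U | U in [set U : set G | open U /\ K `<=` U]] < (e / D)%:E.
      by rewrite -out ?K0 ?lte_fin ?divr_gt0.
    by move=> /ereal_inf_lt[_ [V [oV KV] <-] mGV]; exists V.
  have [f [cf f01 fK fV cSf]] := urysohn_compact hG lG R cK oV KV.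
  have mV := open_borel oV.
  have f0 x : (0 <= f x)%R by have /andP[] := f01 x.
  have f1 x : (f x <= 1)%R by have /andP[] := f01 x.
  have g0 x : 0 <= (f x / rho x)%:E by rewrite lee_fin divr_ge0// ltW.
  have mg : measurable_fun [set: BG] (fun x : BG => (f x / rho x)%:E).
    apply/measurable_EFinP; apply: continuous_borel_real => x.
    by apply: cvgM; [exact: cf|apply: cvgV; [rewrite gt_eqF|exact: crho]].
  apply: (@le_trans _ _ (\int[lam]_q (D%:E *
      \int[lift_kernel mH q]_x (f x / rho x)%:E))).
    apply: ge0_le_integral => //.
      by apply: emeasurable_funM => //; exact: measurable_lift_kernel_integral.
    move=> q _; rewrite -[in leLHS](setIT K) -(@integral_indic _ _ _ (lift_kernel mH q) setT)//.
    rewrite -ge0_integralZl//; last by rewrite lee_fin ltW.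
    apply: ge0_le_integral => //.
    - by apply/measurable_EFinP; exact: measurable_indic.
    - exact: emeasurable_funM.
    - move=> x _; rewrite lee_fin; have [Kx|Kx] := pselect (K x).
        by rewrite indicE mem_set// fK// mul1r ler_pdivlMr// mul1r rhoD.
      by rewrite indicE memNset// mulr_ge0 ?divr_ge0// ltW.
  rewrite ge0_integralZl//; last 3 first.
  - exact: measurable_lift_kernel_integral.
  - by move=> q _; exact: integral_ge0.
  - by rewrite lee_fin ltW.
  rewrite -weil_ge0//.
  apply: (@le_trans _ _ (D%:E * mG V)); last first.
    rewrite (_ : e%:E = D%:E * (e / D)%:E); first by apply: lee_wpmul2l; rewrite ?lee_fin ltW.
    by rewrite -EFinM mulrC divfK// gt_eqF.
  apply: lee_wpmul2l; first by rewrite lee_fin ltW.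
  rewrite -[V]setIT -(@integral_indic _ _ _ mG setT)//.
  apply: ge0_le_integral => //.
  - by move=> x _; rewrite lee_fin.
  - by apply/measurable_EFinP; exact: continuous_borel_real.
  - by apply/measurable_EFinP; exact: measurable_indic.
  - move=> x _; rewrite lee_fin; have [Vx|Vx] := pselect (V x).
      by rewrite indicE mem_set.
    by rewrite fV.
have absE q : `|lift_kernel mH q K| = lift_kernel mH q K by rewrite gee0_abs.
(* A nonnegative function with integral 0 vanishes [lam]-almost everywhere, hence [p]-almost
   everywhere by absolute continuity. *)
have : ae_eq lam setT (fun q => lift_kernel mH q K) (cst 0).
  apply/ae_eq_integral_abs => //.
  by under eq_integral => q _ do rewrite absE.
move=> [N [mN lamN sub]].
rewrite (@ge0_ae_eq_integral _ _ _ p setT _ (cst 0))//; first exact: integral0.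
by exists N; split => //; exact: pnull.
Qed.

End weil.

(** * Translates of null sets and the ideal property *)

Section translate.
Context {R : realType} {G : topologicalGroupType}.
Variable mG : {measure set (borel G) -> \bar R}.
Hypothesis haarG : left_haar mG.
Hypothesis hG : hausdorff_space G.

Lemma left_translate_preimage (L : set G) x :
  [set y | L (x * y)%g] = [set (x^-1 * y)%g | y in L].
Proof.
apply/seteqP; split => y /=.
  by move=> Lxy; exists (x * y)%g => //; rewrite mulKg.
by move=> [z Lz <-]; rewrite mulVKg.
Qed.

Lemma right_translate_preimage (L : set G) x :
  [set y | L (y * x)%g] = [set (y * x^-1)%g | y in L].
Proof.
apply/seteqP; split => y /=.
  by move=> Lxy; exists (y * x)%g => //; rewrite mulgK.
by move=> [z Lz <-]; rewrite mulgVK.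
Qed.

Lemma null_left_translate (L : set G) x : compact L -> mG L = 0%E ->
  compact [set y | L (x * y)%g] /\ mG [set y | L (x * y)%g] = 0%E.
Proof.
move=> cL L0; rewrite left_translate_preimage; split.
  apply: continuous_compact cL.
  by apply: continuous_subspaceT; exact: mulgl_continuous.
by have [_ _ ->] := haarG; [|exact: compact_borel].
Qed.

Lemma null_right_translate (Delta : G -> R) (L : set G) x :
  modular mG Delta -> compact L -> mG L = 0%E ->
  compact [set y | L (y * x)%g] /\ mG [set y | L (y * x)%g] = 0%E.
Proof.
move=> [_ mod] cL L0; rewrite right_translate_preimage; split.
  apply: continuous_compact cL.
  by apply: continuous_subspaceT; exact: mulgr_continuous.
by rewrite mod ?L0 ?mule0//; exact: compact_borel.
Qed.

End translate.

Theorem theorem2p17 (R : realType) (G : topologicalGroupType)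
    (lcG : lc_group G)
    (H : subgroup G) (cptH : compact (H : set G))
    (mG : {measure set (borel G) -> \bar R}) (haarG : left_haar mG)
    (mH : {measure set (borel (subgroup_type H)) -> \bar R})
    (haarH : left_haar mH) (normH : mH [set: subgroup_type H] = 1%E)
    (DeltaG : G -> R) (modG : modular mG DeltaG)
    (DeltaH : subgroup_type H -> R) (modH : modular mH DeltaH)
    (rho : G -> R) (rhoP : rho_function DeltaG DeltaH rho)
    (lam : {measure set (borel (coset_space H)) -> \bar R})
    (lam_sqi : strongly_quasi_invariant lam)
    (lam_rho : arises_from mG mH rho lam) :
  two_sided_ideal mH (Lambda lam).
Proof.
have [hG lG] := lcG; have cH := cptH.
have hX := coset_space_hausdorff hG lG cH.
have lamR : radon lam := lam_sqi.1.
have mGR : radon mG by case: haarG.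
have [crho rho0 _] := rhoP.
have preimage_null := null_preimage hG lG cH mGR haarH normH crho rho0 lamR lam_rho.
have lift_null := null_lift hG lG cH mGR haarH normH crho rho0 lamR lam_rho.
split.
- exact: Lambda_sub_M.
- exact: Lambda_cm0.
- exact: Lambda_cmadd.
- exact: Lambda_cmscale.
move=> sigma nu Ms Lnu; have Mnu := Lambda_sub_M hX lamR Lnu.
have [s [sP _]] := lift_PH_ex hG lG cH haarH normH Ms.
have [n [nP n_le]] := lift_PH_ex hG lG cH haarH normH Mnu.
(* What absolute continuity of [nu] leaves on [G], and all that both products use of it. *)
have n_null i L : compact L -> mG L = 0%E -> piece n i L = 0%E.
  move=> cL L0; apply/eqP; rewrite -measure_le0.
  have mL := compact_borel hG cL.
  rewrite (le_trans (n_le i L mL))// lift_null// => E mE E0.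
  exact: Lambda_null Lnu mE E0.
have sR i := piece_finite_radon i sP.1.
have nR i := piece_finite_radon i nP.1.
split.
- have [mu [muP mu_null]] := conv_group_ex hG lG sP.1 nP.1.
  have [kappa [kP k_le]] := push_RH_ex hG lG cH muP.1.
  exists kappa; first by exists s, n, mu.
  apply: (Lambda_of_null hX lamR kP.1) => i K cK K0.
  have cL := compact_coset_preimage hG lG cH cK.
  have mL := compact_borel hG cL.
  apply/eqP; rewrite -measure_le0.
  rewrite (le_trans (k_le i K (compact_borel hX cK)))// mu_null// => a b.
  (* Here the absolutely continuous factor is the outer measure, so the nullity of its left
     translates is brought in by exchanging the integrations. *)
  apply: null_convolution => // x.
  have [cx x0] := null_left_translate haarG hG x cL (preimage_null _ cK K0).
  exact: n_null.
- have [mu [muP mu_null]] := conv_group_ex hG lG nP.1 sP.1.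
  have [kappa [kP k_le]] := push_RH_ex hG lG cH muP.1.
  exists kappa; first by exists n, s, mu.
  apply: (Lambda_of_null hX lamR kP.1) => i K cK K0.
  have cL := compact_coset_preimage hG lG cH cK.
  have mL := compact_borel hG cL.
  apply/eqP; rewrite -measure_le0.
  rewrite (le_trans (k_le i K (compact_borel hX cK)))// mu_null// => a b.
  (* Here it is the inner measure, and the integrand already vanishes at every [y]. *)
  apply: integral0_eq => y _; rewrite rtransE.
  have [cy y0] := null_right_translate hG y modG cL (preimage_null _ cK K0).
  exact: n_null.
Qed.
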